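(* Let $g:\mathbb{R}^n\to\mathbb{R}$ be Lipschitz continuous and $\mathbb{Z}^n$-periodic, and assume that there exists a set $A\subseteq Q=(0,1)^n$ (of finite periodic perimeter) such that $\int_A g(y)\,dy>\mathrm{Per}(A,\mathbb{T}^n)$. Then there exists a unique constant $\overline{c}>0$, with $\int_Q g\le\overline{c}\le\max_Q g$, such that: (i) if $0<c<\overline{c}$, then $\inf\{F_c(\psi): e^{c\psi}\in BV_{\rm per}(Q)\}=-\infty$; (ii) if $c>\overline{c}$, then $\inf\{F_c(\psi): e^{c\psi}\in BV_{\rm per}(Q)\}=0$, and $F_c(\psi)>0$ for all $\psi\not\equiv-\infty$ with $e^{c\psi}\in BV_{\rm per}(Q)$; (iii) there exists $\psi:Q\to[-\infty,+\infty)$ such that $\psi\not\equiv-\infty$, $e^{\overline{c}\psi}\in BV_{\rm per}(Q)$ and $F_{\overline{c}}(\psi)=0$. In (i) and (ii) $\psi$ ranges over measurable functions $\psi:Q\to[-\infty,+\infty)$.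
   Context: $n\ge 1$, $Q:=(0,1)^n$, $\mathbb{T}^n:=\mathbb{R}^n/\mathbb{Z}^n$. $BV_{\rm per}(Q)$ is the space $BV(Q)$ with the periodic total variation; it coincides with $BV(\mathbb{T}^n)$. For $E\subseteq Q$, $\mathrm{Per}(E,\mathbb{T}^n)$ is the perimeter of $E$ in $\mathbb{T}^n$. $\mathcal{C}^1_{\rm per}$ denotes $\mathbb{Z}^n$-periodic $\mathcal{C}^1$ functions. Functions are identified if they agree a.e., so $\psi\not\equiv-\infty$ means that $\psi$ is not a.e. equal to $-\infty$. For $c>0$ and measurable $\psi:Q\to[-\infty,+\infty)$ with $e^{c\psi}\in BV_{\rm per}(Q)$ (convention $e^{-\infty}=0$), $$F_c(\psi):=\sup\left\{\int_Q e^{c\psi}\left(\frac{\mathrm{div}\,\phi'}{c}+\phi_{n+1}\right)dy:\ (\phi',\phi_{n+1})\in\mathcal{C}^1_{\rm per}(Q;\mathbb{R}^n\times\mathbb{R}),\ |\phi'|^2+\phi_{n+1}^2\le1\right\}-\int_Q\frac{e^{c\psi}}{c}\,g\,dy.$$ For $\psi\in\mathcal{C}^1_{\rm per}(Q)$ this equals $\int_Q e^{c\psi}\left(\sqrt{1+|D\psi|^2}-\frac{g}{c}\right)dy$. *)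

(* Defs.v *)
From HB Require Import structures.
From mathcomp Require Import all_boot all_order all_algebra.
From mathcomp Require Import all_classical all_reals all_analysis.
From mathcomp Require Import measurable_realfun.
Set Implicit Arguments.
Unset Strict Implicit.
Unset Printing Implicit Defensive.
Import Order.TTheory GRing.Theory Num.Theory.
Import numFieldNormedType.Exports.
Local Open Scope classical_set_scope.
Local Open Scope ring_scope.

(* R^n is 'rV[R]_n, which already carries the normed structure; it receives
   here the product (i.e. Borel) sigma-algebra, generated by the coordinates. *)
Section measurable_rV.
Context {R : realType} (n : nat).

Let coor (i : 'I_n) (x : 'rV[R]_n) : R := x 0 i.

Let rV_set0 : g_sigma_preimage coor set0.
Proof. exact: sigma_algebra0. Qed.

Let rV_setC A : g_sigma_preimage coor A -> g_sigma_preimage coor (~` A).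
Proof. exact: sigma_algebraC. Qed.

Let rV_bigcup (F : _^nat) : (forall i, g_sigma_preimage coor (F i)) ->
  g_sigma_preimage coor (\bigcup_i F i).
Proof. exact: sigma_algebra_bigcup. Qed.

HB.instance Definition _ := @isMeasurable.Build default_measure_display
  'rV[R]_n (g_sigma_preimage coor) rV_set0 rV_setC rV_bigcup.

Lemma measurable_coord (i : 'I_n) :
  measurable_fun [set: 'rV[R]_n] (fun x : 'rV[R]_n => x 0 i).
Proof.
move=> _ Y mY; rewrite setTI; apply: sub_sigma_algebra => /=.
rewrite -bigcup_seq/=; exists i => /=; first by rewrite mem_index_enum.
by exists Y => //; rewrite setTI.
Qed.

Lemma measurable_fun_rVP d (T : measurableType d) (f : T -> 'rV[R]_n) :
  measurable_fun [set: T] f <->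
  forall i, measurable_fun [set: T] (fun x => f x 0 i).
Proof.
split=> [mf i|mf].
  by apply: (measurableT_comp (measurable_coord i)).
move=> _ A mA; rewrite setTI.
suff : <<s \big[setU/set0]_(i < n) preimage_set_system setT (coor i) measurable >>
    `<=` [set B | measurable (f @^-1` B)] by exact.
apply: smallest_sub.
  split => /=.
  - by rewrite preimage_set0.
  - by move=> B mB; rewrite setTD preimage_setC; exact: measurableC.
  - by move=> F mF; rewrite preimage_bigcup; exact: bigcup_measurable.
rewrite -bigcup_seq/= => B [i _] [C mC <-] /=.
by rewrite setTI -comp_preimage -[X in measurable X]setTI; exact: mf.
Qed.

End measurable_rV.

(* n-dimensional Lebesgue measure: the image of lebesgue_measure \x leb n
   under the identification of R * R^n with R^(n+1). *)
Section cons_measure.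
Context {R : realType} (n : nat).
Implicit Types (p : measurableTypeR R * 'rV[R]_n) (x : 'rV[R]_n.+1).

Definition rV_cons p : 'rV[R]_n.+1 := row_mx (const_mx p.1 : 'rV_1) p.2.
Definition rV_uncons x : measurableTypeR R * 'rV[R]_n :=
  (lsubmx (x : 'rV_(1 + n)) 0 0, rsubmx (x : 'rV_(1 + n))).

Lemma rV_consK : cancel rV_cons rV_uncons.
Proof.
case=> a v; congr pair; rewrite /rV_cons; last exact: row_mxKr.
by rewrite row_mxKl mxE.
Qed.

Lemma measurable_rV_cons : measurable_fun setT rV_cons.
Proof.
apply/measurable_fun_rVP => i.
rewrite -[i](@splitK 1 n); case: (fintype.split _) => j /=.
- rewrite (_ : (fun _ => _) = fst); first exact: measurable_fst.
  by apply/funext => p; rewrite [LHS](row_mxEl (const_mx p.1)) mxE.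
- rewrite (_ : (fun _ => _) = (fun v : 'rV_n => v 0 j) \o snd).
    by apply: measurableT_comp; [exact: measurable_coord|exact: measurable_snd].
  by apply/funext => p; rewrite [LHS](row_mxEr (const_mx p.1)).
Qed.

Lemma measurable_rV_uncons : measurable_fun setT rV_uncons.
Proof.
apply: measurable_fun_pair.
  rewrite (_ : (fun _ => _) = (fun x : 'rV[R]_n.+1 => x 0 (lshift n (0 : 'I_1)))).
    exact: measurable_coord.
  by apply/funext => x; rewrite mxE.
apply/measurable_fun_rVP => i.
rewrite (_ : (fun _ => _) = (fun x : 'rV[R]_n.+1 => x 0 (rshift 1 i))).
  exact: measurable_coord.
by apply/funext => x; rewrite mxE.
Qed.

Variable mu : {sigma_finite_measure set 'rV[R]_n -> \bar R}.

Definition cons_measure : set 'rV[R]_n.+1 -> \bar R :=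
  pushforward (lebesgue_measure \x mu)%E rV_cons.

Let cons_measure0 : cons_measure set0 = 0%E.
Proof. by rewrite /cons_measure /pushforward preimage_set0 measure0. Qed.

Let cons_measure_ge0 A : (0 <= cons_measure A)%E.
Proof. by rewrite /cons_measure /pushforward measure_ge0. Qed.

Let cons_measure_sigma_additive : semi_sigma_additive cons_measure.
Proof.
move=> F mF tF mUF; rewrite /cons_measure /pushforward preimage_bigcup.
have mcons A : measurable A -> measurable (rV_cons @^-1` A).
  by move=> mA; rewrite -[X in measurable X]setTI; exact: measurable_rV_cons.
apply: measure_semi_sigma_additive.
- by move=> k; exact: mcons.
- apply/trivIsetP => /= i j _ _ ij; rewrite -preimage_setI.
  by move/trivIsetP : tF => /(_ _ _ _ _ ij) ->//; rewrite preimage_set0.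
- by rewrite -preimage_bigcup; exact: mcons.
Qed.

HB.instance Definition _ := isMeasure.Build _ _ _ cons_measure
  cons_measure0 cons_measure_ge0 cons_measure_sigma_additive.

Let cons_measure_sigma_finite : sigma_finite setT cons_measure.
Proof.
have /sigma_finiteP[F [TF ndF Foo]] := sigma_finiteT (@lebesgue_measure R).
have /sigma_finiteP[G [TG ndG Goo]] := sigma_finiteT mu.
exists (fun k => rV_uncons @^-1` (F k `*` G k)).
  apply/esym; rewrite -preimage_bigcup (_ : \bigcup_k _ = setT) ?preimage_setT//.
  rewrite -subTset => -[x y] _.
  have [i _ Fix] : (\bigcup_i F i) x by rewrite -TF.
  have [j _ Gjy] : (\bigcup_j G j) y by rewrite -TG.
  exists (maxn i j) => //; split => /=.
  - by move: x Fix; exact/subsetPset/ndF/leq_maxl.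
  - by move: y Gjy; exact/subsetPset/ndG/leq_maxr.
move=> k; have [mF Fk] := Foo k; have [mG Gk] := Goo k; split.
  rewrite -[X in measurable X]setTI; apply: measurable_rV_uncons => //.
  exact: measurableX.
rewrite /cons_measure /pushforward -comp_preimage.
rewrite (_ : rV_uncons \o rV_cons = id); last exact/funext/rV_consK.
by rewrite preimage_id product_measure1E// lte_mul_pinfty// ge0_fin_numE.
Qed.

HB.instance Definition _ := Measure_isSigmaFinite.Build _ _ _ cons_measure
  cons_measure_sigma_finite.

End cons_measure.

Fixpoint leb {R : realType} (n : nat) :
    {sigma_finite_measure set 'rV[R]_n -> \bar R} :=
  if n is m.+1 then cons_measure (leb m) else dirac (0 : 'rV[R]_0).

Section periodic_BV.
Context {R : realType} {n : nat}.

Definition Q : set 'rV[R]_n := [set x | forall i, 0 < x 0 i < 1].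

Definition Zperiodic (T : Type) (f : 'rV[R]_n -> T) : Prop :=
  forall (k : 'rV[int]_n) x, f (x + map_mx intr k) = f x.

Definition C1per m (f : 'rV[R]_n -> 'rV[R]_m) : Prop :=
  [/\ forall x, differentiable f x, continuous (jacobian f) & Zperiodic f].

(* Squared Euclidean norm; `|v| is the sup norm on row vectors. *)
Definition sqnorm m (v : 'rV[R]_m) : R := \sum_i v 0 i ^+ 2.

Definition div (f : 'rV[R]_n -> 'rV[R]_n) (x : 'rV[R]_n) : R := \tr ('J f x).

(* Total variation on the torus: the test fields are periodic and need not
   vanish on the boundary of Q. *)
Definition TVper (u : 'rV[R]_n -> R) : \bar R :=
  ereal_sup [set (\int[leb n]_(x in Q) (u x * div phi x)%:E)%E |
    phi in [set phi | C1per phi /\ forall x, sqnorm (phi x) <= 1]].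

Definition BVper (u : 'rV[R]_n -> R) : Prop :=
  (leb n).-integrable Q (EFin \o u) /\ (TVper u < +oo)%E.

Definition Per (A : set 'rV[R]_n) : \bar R := TVper \1_A.

(* exp (c psi), with exp -oo = 0; the value of fine at +oo is irrelevant since
   psi < +oo on Q. *)
Definition expc (c : R) (psi : 'rV[R]_n -> \bar R) (x : 'rV[R]_n) : R :=
  fine (expeR (c%:E * psi x)).

Definition admissible (c : R) (psi : 'rV[R]_n -> \bar R) : Prop :=
  [/\ measurable_fun Q psi, forall x, Q x -> (psi x < +oo)%E
    & BVper (expc c psi)].

(* A test field phi is (phi', phi_{n+1}) : R^n -> R^n * R. *)
Definition F (g : 'rV[R]_n -> R) (c : R) (psi : 'rV[R]_n -> \bar R) : \bar R :=
  (ereal_sup [set \int[leb n]_(x in Q)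
      (expc c psi x *
        (div (fun y => lsubmx (phi y)) x / c + rsubmx (phi x) 0 0))%:E |
    phi in [set phi : 'rV[R]_n -> 'rV[R]_(n + 1) |
      C1per phi /\ forall x, (sqnorm (phi x) <= 1)%R]]
  - \int[leb n]_(x in Q) (expc c psi x / c * g x)%:E)%E.

End periodic_BV.

(* Main.v *)
Require Import Defs.
From mathcomp Require Import all_boot all_order all_algebra.
From mathcomp Require Import all_classical all_reals all_analysis.
From mathcomp Require Import measurable_realfun.
From mathcomp Require Import ring lra.
Import Order.TTheory GRing.Theory Num.Theory.
Import numFieldNormedType.Exports.
Local Open Scope classical_set_scope.
Local Open Scope ring_scope.
Set Implicit Arguments.
Unset Strict Implicit.
Unset Printing Implicit Defensive.

(** Write u = exp (c psi), a nonnegative density.  Up to the factor c, the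
    functional is J_c(u) - (integral of u g), where the energy
    J_c(u) = sup (integral of u (div f + c h)), over periodic C^1 pairs with
    |f|^2 + h^2 <= 1, is the mass of sqrt (|Du|^2 + (c u)^2).  It is
    1-homogeneous in u, and convex and nondecreasing in c.

    The threshold is the supremum of the set of subcritical c, those for which
    some density has a negative value.  The indicator of A shows that this set
    is not empty (indicator_subcritical); the constant density, whose energy is
    c by the divergence theorem, that it contains every positive c below the
    mean of g (mean_subcritical); and J_c(u) >= c (integral of u), that it lies
    below the supremum of g (subcritical_lt_sup).  Below the threshold, scaling
    a density of negative value drives the functional to -oo.  Above it the
    values are strictly positive, because the energy is strictly increasing in c
    on densities of positive mass: tilting test fields gives
    J_c(u) >= sqrt (TV(u)^2 + (c m)^2), where m is the mass of u, so that
    J_c(u) > TV(u) = J_0(u), and convexity in c does the rest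
    (energy_le_TV_lt, energy_le_strict).

    At the threshold itself, a minimizer is a weak limit of densities of mass 1
    with negative values for c_k increasing to the threshold
    (critical_minimizer).  This needs weak compactness in BV of the torus
    (BV_compact), which is proved here with dyadic cells.  Cells are named by
    words of binary digits of the coordinates, and a digit is an everywhere
    limit of smooth periodic functions (cvg_smooth_bit).  Pairing u with the
    difference of such functions and their translates (TV_translate) bounds the
    sum, over the cells of a given width h, of the differences between the
    masses of the two halves by h TV(u) / 2 (mass_halves).  This bound survives
    the limit of the masses along an ultrafilter, and it makes the densities on
    finer and finer cells a Cauchy sequence in L^1 (martingale_limit). *)

(** * Borel functions of row vectors *)

Section measurability.
Context {R : realType} {n : nat}.

Lemma rV_ballP (x y : 'rV[R]_n) e : 0 < e ->
  (forall i, `|x 0 i - y 0 i| < e) -> ball x e y.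
Proof. by move=> e0 H; split=> // i j; rewrite ord1; exact: H. Qed.

Definition grid (k : nat) (x : 'rV[R]_n) : 'rV[int]_n :=
  \row_i Num.floor (k.+1%:R * x 0 i).

Lemma grid_near (k : nat) (x : 'rV[R]_n) i :
  `|x 0 i - (grid k x 0 i)%:~R / k.+1%:R| < k.+1%:R^-1.
Proof.
have k0 : (0 : R) < k.+1%:R by rewrite ltr0n.
rewrite mxE; set f := Num.floor _.
have := floor_itv (k.+1%:R * x 0 i); rewrite -/f => /andP[f1 f2].
rewrite -[X in X - _](mulfK (lt0r_neq0 k0)) -mulrBl normrM [`|_^-1|]gtr0_norm ?invr_gt0//.
rewrite gtr_pMl ?invr_gt0// ger0_norm mulrC ?subr_ge0//.
by rewrite ltrBlDr addrC -[X in _ + X]/(1%:~R) -intrD.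
Qed.

Lemma measurable_grid k (z : 'rV[int]_n) : measurable [set x | grid k x = z].
Proof.
rewrite (_ : [set _ | _] = \bigcap_(i in [set: 'I_n])
    ((fun x : 'rV[R]_n => x 0 i) @^-1` [set t | Num.floor (k.+1%:R * t) = z 0 i])).
  apply: fin_bigcap_measurable => // i _.
  rewrite -[X in measurable X]setTI; apply: measurable_coord => //.
  rewrite (_ : [set t | _] = (fun t => k.+1%:R * t) @^-1` (`[(z 0 i)%:~R, (z 0 i + 1)%:~R[)).
    rewrite -[X in measurable X]setTI.
    exact: measurable_funM.
  apply/seteqP; split => t /=.
    by move=> <-; rewrite in_itv/= floor_itv.
  by rewrite in_itv/= => H; exact: floor_def.
apply/seteqP; split => x /=.
  by move=> <- i _; rewrite /= mxE.
by move=> H; apply/rowP => i; rewrite mxE; exact: H.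
Qed.

(** The sigma-algebra generated by the coordinates contains the open sets:
    a continuous function is the limit of its samples on finer and finer
    grids, which take countably many values on measurable sets. *)
Lemma continuous_measurable_rV (f : 'rV[R]_n -> R) :
  continuous f -> measurable_fun setT f.
Proof.
move=> cf.
pose pt k (z : 'rV[int]_n) : 'rV[R]_n := \row_i ((z 0 i)%:~R / k.+1%:R).
apply: (@measurable_fun_cvg _ _ _ setT (fun k x => f (pt k (grid k x)))).
  move=> k _ B mB; rewrite setTI.
  rewrite (_ : _ @^-1` _ =
     \bigcup_z ([set x | grid k x = z] `&` [set _ | B (f (pt k z))])).
    apply: countable_bigcupT_measurable => [|z]; first exact: countableP.
    have [Bz|Bz] := pselect (B (f (pt k z))).
      rewrite [X in _ `&` X](_ : _ = setT) ?setIT; first exact: measurable_grid.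
      by apply/seteqP; split.
    rewrite [X in _ `&` X](_ : _ = set0) ?setI0; first exact: measurable0.
    by apply/seteqP; split.
  apply/seteqP; split => [x /= Bx|x /= [z _ [/= <-//]]].
  by exists (grid k x).
move=> x _.
apply: (@cvg_comp _ _ _ (fun k => pt k (grid k x)) f) (cf x).
apply/cvg_ballP => e e0.
near=> k.
apply: rV_ballP => // i.
rewrite mxE; apply: lt_le_trans (grid_near _ _ _) _.
rewrite -[leRHS]invrK lef_pV2 ?posrE ?invr_gt0 ?ltr0n//.
have ek : e^-1 <= k%:R by near: k; exact: nbhs_infty_ger.
by rewrite (le_trans ek)// ler_nat.
Unshelve. all: by end_near.
Qed.

Lemma measurable_Q : measurable (@Q R n).
Proof.
rewrite (_ : Q = \bigcap_(i in [set: 'I_n])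
    ((fun x : 'rV[R]_n => x 0 i) @^-1` `]0, 1[)).
  apply: fin_bigcap_measurable => // i _.
  by rewrite -[X in measurable X]setTI; apply: measurable_coord.
apply/seteqP; split => x /= H i; first by move=> _; rewrite /= in_itv/=; exact: H.
by have := H i I; rewrite /= in_itv.
Qed.

End measurability.

(** * Integration over the unit cube *)

Section cube_integral.
Context {R : realType}.

Lemma rV_consl n (t : R) (y : 'rV[R]_n) j :
  rV_cons (t, y) 0 (lshift n (j : 'I_1)) = t.
Proof. by rewrite [LHS](row_mxEl (const_mx t)) mxE. Qed.

Lemma rV_consr n (t : R) (y : 'rV[R]_n) j :
  rV_cons (t, y) 0 (rshift 1 j) = y 0 j.
Proof. by rewrite [LHS](row_mxEr (const_mx t)). Qed.

Lemma Q_cons n : @rV_cons R n @^-1` Q = (`]0, 1[ : set (measurableTypeR R)) `*` Q.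
Proof.
apply/seteqP; split => -[t y] H; last first.
  case: H => /=; rewrite in_itv/= => t01 yQ i; rewrite -[i](@splitK 1 n).
  by case: (fintype.split _) => j; rewrite (rV_consl, rV_consr).
split => [|i]; last by have := H (rshift 1 i); rewrite rV_consr.
by have := H (lshift n (0 : 'I_1)); rewrite rV_consl /= in_itv.
Qed.

Lemma leb_Q n : leb n (@Q R n) = 1%E.
Proof.
elim: n => [|n IH].
  rewrite /= diracE mem_set// => -[]//.
rewrite /= /cons_measure /pushforward Q_cons product_measure1E; [|exact: measurable_itv|exact: measurable_Q].
by rewrite IH mule1 /= lebesgue_measure_itv/= lte_fin ltr01 oppr0 adde0.
Qed.

Lemma leb_Q_fin n : (leb n (@Q R n) < +oo)%E.
Proof. by rewrite leb_Q ltry. Qed.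

Lemma bounded_integrable_Q n (f : 'rV[R]_n -> R) M : measurable_fun setT f ->
  (forall x, `|f x| <= M) -> (leb n).-integrable Q (EFin \o f).
Proof.
move=> mf fM; apply: measurable_bounded_integrable.
- exact: measurable_Q.
- exact: leb_Q_fin.
- exact: measurable_funTS.
- exists M; split; first exact: num_real.
  by move=> x Mx y _; apply: le_trans (fM y) _; exact: ltW.
Qed.

Section fubini_cons.
Variables (n : nat) (f : 'rV[R]_n.+1 -> R) (M : R).
Hypotheses (mf : measurable_fun setT f) (fM : forall x, `|f x| <= M).
Let I : set (measurableTypeR R) := `]0, 1[.
Let h (p : measurableTypeR R * 'rV[R]_n) : \bar R := (f (rV_cons p))%:E.

Let mh : measurable_fun setT h.
Proof. apply/measurable_EFinP. exact: (measurableT_comp mf (@measurable_rV_cons R n)). Qed.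

Let mIQ : measurable (I `*` @Q R n).
Proof. by apply: measurableX; [exact: measurable_itv|exact: measurable_Q]. Qed.

Let ih : (lebesgue_measure \x leb n)%E.-integrable (I `*` @Q R n) h.
Proof.
apply: measurable_bounded_integrable => //.
- rewrite [X in (X < _)%E](_ : _ = (lebesgue_measure I * leb n (@Q R n))%E).
    by rewrite leb_Q mule1 /= lebesgue_measure_itv/= lte_fin ltr01 ltry.
  by apply: product_measure1E; [exact: measurable_itv|exact: measurable_Q].
- by apply: measurable_funTS; exact: (measurableT_comp mf (@measurable_rV_cons R n)).
- exists M; split; first exact: num_real.
  by move=> x Mx y _; apply: le_trans (fM _) _; exact: ltW.
Qed.

Let ih' : (lebesgue_measure \x leb n)%E.-integrable setT (h \_ (I `*` @Q R n)).
Proof. exact/(integrable_mkcond _ mIQ).1. Qed.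

Let step1 : (\int[leb n.+1]_(x in Q) (f x)%:E =
  \int[(lebesgue_measure \x leb n)%E]_p ((h \_ (I `*` @Q R n)) p))%E.
Proof.
rewrite -integral_mkcond -Q_cons.
apply: (@integral_pushforward _ _ _ _ R (@rV_cons R n) (@measurable_rV_cons R n)
  (lebesgue_measure \x leb n)%E Q (EFin \o f)).
- exact/measurable_EFinP.
- by rewrite Q_cons.
- exact: measurable_Q.
Qed.

Lemma integral_cons_tx : (\int[leb n.+1]_(x in Q) (f x)%:E =
  \int[lebesgue_measure]_(t in `]0%R, 1%R[) \int[leb n]_(y in Q) (f (rV_cons (t, y)))%:E)%E.
Proof.
rewrite step1 -integral12_prod_meas1// [RHS]integral_mkcond.
apply: eq_integral => t _; rewrite /fubini_F patchE.
case: ifPn => tI.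
  rewrite [RHS]integral_mkcond; apply: eq_integral => y _.
  by rewrite !patchE in_setX/= tI.
by apply: integral0_eq => y _; rewrite patchE in_setX/= (negbTE tI).
Qed.

Lemma integral_cons_xt : (\int[leb n.+1]_(x in Q) (f x)%:E =
  \int[leb n]_(y in Q) \int[lebesgue_measure]_(t in `]0%R, 1%R[) (f (rV_cons (t, y)))%:E)%E.
Proof.
rewrite step1 -integral21_prod_meas1// [RHS]integral_mkcond.
apply: eq_integral => y _; rewrite /fubini_G patchE.
case: ifPn => yQ.
  rewrite [RHS]integral_mkcond; apply: eq_integral => t _.
  by rewrite !patchE in_setX/= yQ andbT.
by apply: integral0_eq => t _; rewrite patchE in_setX/= (negbTE yQ) andbF.
Qed.

End fubini_cons.

Definition setc n (x : 'rV[R]_n) (i : 'I_n) (t : R) : 'rV[R]_n :=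
  \row_j if j == i then t else x 0 j.

(** Fubini along one coordinate.  The measure splits off the first coordinate,
    so the induction on the dimension integrates that coordinate first if it is
    the chosen one, and last otherwise. *)
Lemma integral_coord0 n (i : 'I_n) (f : 'rV[R]_n -> R) (M : R) :
  measurable_fun setT f -> (forall x, `|f x| <= M) ->
  (forall x, \int[lebesgue_measure]_(t in `]0%R, 1%R[) (f (setc x i t))%:E = 0)%E ->
  (\int[leb n]_(x in Q) (f x)%:E = 0)%E.
Proof.
elim: n i f => [[]//|n IH] i f mf fM f0.
rewrite -[i](@splitK 1 n) in f0 *; case: (fintype.split _) f0 => j /= f0.
  rewrite (integral_cons_xt mf fM)//; apply: integral0_eq => y _.
  rewrite -[RHS](f0 (rV_cons (0, y))); apply: eq_integral => t _; congr (f _)%:E.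
  apply/rowP => k; rewrite -[k](@splitK 1 n); case: (fintype.split _) => l /=.
    by rewrite [RHS]mxE (ord1 l) (ord1 j) eqxx rV_consl.
  by rewrite [RHS]mxE (eq_rlshift l j : (rshift 1 l == lshift n j :> 'I_n.+1) = _) !rV_consr.
rewrite (integral_cons_tx mf fM)//; apply: integral0_eq => t _.
apply: (IH j) => [||y].
- apply: (measurableT_comp mf); apply: measurableT_comp (@measurable_rV_cons R n) _.
  exact: measurable_pair1.
- by move=> y; exact: fM.
rewrite -[RHS](f0 (rV_cons (t, y))); apply: eq_integral => s _; congr (f _)%:E.
apply/rowP => k; rewrite -[k](@splitK 1 n); case: (fintype.split _) => l /=.
  by rewrite [RHS]mxE (eq_lrshift l j : (lshift n l == rshift 1 j :> 'I_n.+1) = _) !rV_consl.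
by rewrite [RHS]mxE (inj_eq (@rshift_inj 1 n) l j : (rshift 1 l == rshift 1 j :> 'I_n.+1) = _) !rV_consr mxE.
Qed.

End cube_integral.

(** * Periodic functions of class C^1 *)

(** Heine's theorem.  The second point may lie outside of K, which serves for
    points near the boundary of the cube. *)
Lemma compact_uniform_continuous {R : realType} (U V : pseudoMetricType R)
    (f : U -> V) (K : set U) (e : R) : compact K -> continuous f -> 0 < e ->
  exists2 d, 0 < d & forall x y, K x -> ball x d y -> ball (f x) e (f y).
Proof.
move=> /compact_near_coveringP Kc fc e0.
have /Kc H : forall x, K x -> \forall x' \near x & d \near 0^'+,
    forall y, ball x' d y -> ball (f x') e (f y).
  move=> x Kx.
  have /nbhs_ballP[d/= d0 Hd] : nbhs x (f @^-1` ball (f x) (e / 2)).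
    by apply: fc; apply: nbhsx_ballx; rewrite divr_gt0.
  exists (ball x (d / 2), [set t | t < d / 2]) => /=.
    split; first by apply: nbhsx_ballx; rewrite divr_gt0.
    by apply: nbhs_right_lt; rewrite divr_gt0.
  move=> [x' t] [/= xx' td] y x'y.
  apply: (@ball_splitr _ _ (f x)).
    apply: Hd; apply: le_ball xx'.
    by rewrite ler_pdivrMr// ler_pMr// ler1n.
  apply: Hd; apply: (@ball_split _ _ x') => //.
  by apply: le_ball x'y; exact: ltW.
near (0%R : R)^'+ => d.
exists d => // x y Kx; have : K `<=` (fun x => forall y, ball x d y -> ball (f x) e (f y)).
  by near: d.
by move=> /(_ x Kx); exact.
Unshelve. all: by end_near.
Qed.

Lemma eq_lim_fmap (T : Type) (U : pnbhsType) (F : set_system T) (f g : T -> U) :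
  f =1 g -> lim (f @ F) = lim (g @ F).
Proof. by move=> /funext ->. Qed.

Section periodic_calculus.
Context {R : realType}.

Section scalar.
Context {n : nat}.
Implicit Types (f g : 'rV[R]_n -> R) (x : 'rV[R]_n).

Definition partial (i : 'I_n) f x : R := 'D_(delta_mx 0 i) f x.

(** The scalar analogue of C1per: a field is C^1 and periodic when its
    components are. *)
Definition C1s f := [/\ forall x, differentiable f x,
  forall i, continuous (partial i f) & Zperiodic f].

Lemma C1s_continuous f : C1s f -> continuous f.
Proof. by move=> [df _ _] x; exact: differentiable_continuous. Qed.

Lemma partial_cst i (a : R) x : partial i (fun=> a) x = 0.
Proof. exact: derive_cst. Qed.

Lemma partialD i f g x : C1s f -> C1s g -> partial i (fun y => f y + g y) x = partial i f x + partial i g x.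
Proof. by move=> [df _ _] [dg _ _]; apply: deriveD; exact: diff_derivable. Qed.

Lemma partialM i f g x : C1s f -> C1s g ->
  partial i (fun y => f y * g y) x = f x * partial i g x + g x * partial i f x.
Proof. by move=> [df _ _] [dg _ _]; apply: deriveM; exact: diff_derivable. Qed.

Lemma C1s_cst a : C1s (fun=> a).
Proof.
split=> // i; rewrite (_ : partial _ _ = fun=> 0); first exact: cst_continuous.
by apply/funext => x; rewrite partial_cst.
Qed.

Lemma C1sD f g : C1s f -> C1s g -> C1s (fun x => f x + g x).
Proof.
move=> cf cg; have [df pf zf] := cf; have [dg pg zg] := cg; split.
- by move=> x; exact: differentiableD.
- move=> i; rewrite (_ : partial _ _ = fun x => partial i f x + partial i g x).
    by move=> x; exact: (cvgD (pf i x) (pg i x)).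
  by apply/funext => x; exact: partialD.
- by move=> k x; rewrite zf zg.
Qed.

Lemma C1sM f g : C1s f -> C1s g -> C1s (fun x => f x * g x).
Proof.
move=> cf cg; have [df pf zf] := cf; have [dg pg zg] := cg; split.
- by move=> x; exact: differentiableM.
- move=> i; rewrite (_ : partial _ _ = fun x => f x * partial i g x + g x * partial i f x).
    have fc : continuous f := C1s_continuous cf.
    have gc : continuous g := C1s_continuous cg.
    by move=> x; exact: (cvgD (cvgM (fc x) (pg i x)) (cvgM (gc x) (pf i x))).
  by apply/funext => x; exact: partialM.
- by move=> k x; rewrite zf zg.
Qed.

Lemma partialZ i a f x : C1s f -> partial i (fun y => a * f y) x = a * partial i f x.
Proof.
by move=> cf; rewrite (partialM i x (C1s_cst a) cf) partial_cst mulr0 addr0.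
Qed.

Lemma C1sZ a f : C1s f -> C1s (fun x => a * f x).
Proof. by move=> cf; apply: C1sM => //; exact: C1s_cst. Qed.

Lemma C1s_sum (K : nat) (F : nat -> 'rV[R]_n -> R) : (forall k, C1s (F k)) ->
  C1s (fun x => \sum_(k < K) F k x).
Proof.
move=> cF; elim: K => [|K IH].
  rewrite (_ : (fun _ => _) = fun=> 0); first exact: C1s_cst.
  by apply/funext => x; rewrite big_ord0.
rewrite (_ : (fun _ => _) = fun x => \sum_(k < K) F k x + F K x).
  exact: C1sD.
by apply/funext => x; rewrite big_ord_recr.
Qed.

Lemma partial_sum i (K : nat) (F : nat -> 'rV[R]_n -> R) x : (forall k, C1s (F k)) ->
  partial i (fun x => \sum_(k < K) F k x) x = \sum_(k < K) partial i (F k) x.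
Proof.
move=> cF; elim: K => [|K IH].
  rewrite big_ord0 -[RHS](partial_cst i 0 x); congr (partial i _ x).
  by apply/funext => y; rewrite big_ord0.
rewrite big_ord_recr/= -IH -partialD//; last exact: C1s_sum.
by congr (partial i _ x); apply/funext => y; rewrite big_ord_recr.
Qed.

Lemma partial_shift i f v x : partial i (fun y => f (y - v)) x = partial i f (x - v).
Proof.
rewrite /partial /derive; apply: eq_lim_fmap => h /=.
by rewrite addrA.
Qed.

Lemma C1s_shift f v : C1s f -> C1s (fun x => f (x - v)).
Proof.
move=> [df pf zf]; split.
- move=> x; apply: (@differentiable_comp _ _ _ _ (fun y => y - v) f) => //.
- move=> i x; rewrite (_ : partial _ _ = fun x => partial i f (x - v)).
    apply: (@cvg_comp _ _ _ (fun y => y - v)) (pf i (x - v)).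
    exact: (cvgB (@cvg_id _ (nbhs x)) (@cvg_cst _ v _ (nbhs x) _)).
  by apply/funext => y; exact: partial_shift.
- by move=> k x; rewrite addrAC zf.
Qed.

Lemma partial_Zperiodic i f : Zperiodic f -> Zperiodic (partial i f).
Proof.
move=> zf k x; rewrite /partial /derive; apply: eq_lim_fmap => h /=.
by rewrite zf addrA zf.
Qed.

Lemma is_derive_line f i x (t : R) : C1s f ->
  is_derive t 1 (fun s : R => f (x + s *: delta_mx 0 i)) (partial i f (x + t *: delta_mx 0 i)).
Proof.
move=> [df _ _].
set L := fun s : R => x + s *: delta_mx 0 i.
have dL : is_diff t L (fun s => s *: (delta_mx 0 i : 'rV[R]_n)).
  have := is_diffD (is_diff_cst x t) (is_diff_scalel t (delta_mx 0 i : 'rV[R]_n)).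
  by rewrite add0r.
have dLt : differentiable L t by apply: ex_diff.
have dfL : differentiable (f \o L) t by exact: differentiable_comp.
apply: DeriveDef; first exact/derivable1_diffP.
rewrite deriveE// diff_comp//= (diff_val (is_diff_def := dL)) scale1r.
by rewrite /partial deriveE.
Qed.

Lemma C1s_coord (h : R -> R) (i : 'I_n) :
  (forall t, derivable h t 1) -> continuous h^`()%classic -> (forall t, h (t + 1) = h t) ->
  C1s (fun x => h (x 0 i)).
Proof.
move=> dh ch ph.
have dc x : differentiable (fun x : 'rV[R]_n => x 0 i) x by exact: differentiable_coord.
have dd x : differentiable (fun x : 'rV[R]_n => h (x 0 i)) x.
  apply: (@differentiable_comp _ _ _ _ (fun x : 'rV[R]_n => x 0 i) h) => //.
  exact/derivable1_diffP.
split => //.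
- move=> j; rewrite (_ : partial _ _ = fun x : 'rV[R]_n => (i == j)%:R * h^`()%classic (x 0 i)).
    move=> x.
    have A : {for x, continuous (fun y : 'rV[R]_n => h^`()%classic (y 0 i))}.
      apply: (@continuous_comp _ _ _ (fun y : 'rV[R]_n => y 0 i) h^`()%classic).
        exact: coord_continuous.
      exact: ch.
    exact: (cvgM (@cst_continuous _ _ _ x) A).
  apply/funext => x; rewrite /partial /derive derive1E /derive.
  have [<-|ij] := eqVneq i j.
    rewrite mul1r; apply: eq_lim_fmap => s /=.
    by rewrite !mxE !eqxx mulr1 [_%:A]mulr1.
  rewrite mul0r (_ : (fun _ => _) = fun=> 0); first exact: lim_cst.
  apply/funext => s /=.
  by rewrite !mxE eqxx (negbTE ij) mulr0 add0r subrr scaler0.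
- move=> k x; rewrite !mxE.
  have ppos m t : h (t + m%:R) = h t.
    elim: m t => [|m IH] t; first by rewrite addr0.
    by rewrite -natr1 addrA ph IH.
  case: (k 0 i) => m /=; first exact: ppos.
  by rewrite NegzE rmorphN /= -[in RHS](subrK (m.+1%:R) (x 0 i)) ppos.
Qed.

Definition frac_rV x : 'rV[R]_n := x + map_mx intr (- (\row_i Num.floor (x 0 i))).

Lemma frac_rV_itv x i : 0 <= frac_rV x 0 i < 1.
Proof.
rewrite !mxE rmorphN/= subr_ge0 ltrBlDr -[1 + _]addrC.
by have := floor_itv (x 0 i); rewrite intrD.
Qed.

Lemma Zperiodic_bounded f : continuous f -> Zperiodic f ->
  exists2 M : R, 0 <= M & forall x, `|f x| <= M.
Proof.
move=> cf zf.
have cK := @rV_compact R n (fun=> `[0, 1]%classic) (fun=> @segment_compact R 0 1).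
have := @continuous_compact _ _ f _ (continuous_subspaceT cf) cK.
move=> /compact_bounded[M [_ HM]].
have H x : `|f x| <= `|M| + 1.
  rewrite -(zf (- (\row_i Num.floor (x 0 i))) x) -/(frac_rV x).
  apply: (HM (`|M| + 1)); first by rewrite (le_lt_trans (ler_norm M))// ltrDl.
  exists (frac_rV x) => // i /=.
  by rewrite in_itv/=; have /andP[-> /ltW->] := frac_rV_itv x i.
by exists (`|M| + 1).
Qed.

Lemma C1s_bounded f : C1s f -> exists2 M : R, 0 <= M & forall x, `|f x| <= M.
Proof.
by move=> cf; apply: Zperiodic_bounded; [exact: C1s_continuous|case: cf].
Qed.

Lemma partial_bounded i f : C1s f -> exists2 M : R, 0 <= M & forall x, `|partial i f x| <= M.
Proof.
move=> [_ pf zf]; apply: Zperiodic_bounded; first exact: pf.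
exact: partial_Zperiodic.
Qed.

Lemma measurable_C1s f : C1s f -> measurable_fun setT f.
Proof. by move=> /C1s_continuous; exact: continuous_measurable_rV. Qed.

Lemma measurable_partial i f : C1s f -> measurable_fun setT (partial i f).
Proof. by move=> [_ pf _]; exact: continuous_measurable_rV. Qed.

(** By the fundamental theorem of calculus along the i-th coordinate: the two
    boundary values agree by periodicity. *)
Lemma integral_partial i f : C1s f -> (\int[leb n]_(x in Q) (partial i f x)%:E = 0)%E.
Proof.
move=> cf; have [M _ HM] := partial_bounded i cf.
apply: (integral_coord0 (i := i) (measurable_partial i cf) HM) => x.
pose x0 := setc x i 0.
have E t : setc x i t = x0 + t *: delta_mx 0 i.
  apply/rowP => j; rewrite !mxE eqxx /=; case: (eqVneq j i) => _.
    by rewrite mulr1 add0r.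
  by rewrite mulr0 addr0.
under eq_integral do rewrite E.
have cont (F : 'rV[R]_n -> R) : continuous F -> continuous (fun t : R => F (x0 + t *: delta_mx 0 i)).
  move=> cF t; apply: (@cvg_comp _ _ _ (fun t : R => x0 + t *: delta_mx 0 i) F) (cF _).
  by apply: cvgD; [exact: cvg_cst|exact: scalel_continuous].
have cp : continuous (fun t : R => partial i f (x0 + t *: delta_mx 0 i)).
  by apply: cont; case: cf.
have cf' := cont f (C1s_continuous cf).
rewrite -(@integral_itv_bndoo _ _ _ _ true false); last first.
  by apply/measurable_EFinP; apply: measurable_funTS; exact: continuous_measurable_fun.
rewrite (@continuous_FTC2 _ _ (fun t : R => f (x0 + t *: delta_mx 0 i)) 0 1)//.
- rewrite scale0r addr0 scale1r.
  have [_ _ /(_ (delta_mx 0 i) x0)] := cf.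
  rewrite (_ : map_mx _ _ = delta_mx 0 i) => [->|]; first by rewrite subee.
  by apply/rowP => j; rewrite !mxE; case: (_ && _).
- exact: continuous_subspaceT.
- split.
  + by move=> t _; apply: ex_derive; exact: is_derive_line.
  + exact: cvg_at_right_filter (cf' 0).
  + exact: cvg_at_left_filter (cf' 1).
- by move=> t _; rewrite derive1E; apply: derive_val; exact: is_derive_line.
Qed.

End scalar.
End periodic_calculus.

(** * Test fields and the divergence theorem on the torus *)

Section fields.
Context {R : realType} {n : nat}.

Lemma jacobianE m (phi : 'rV[R]_n -> 'rV[R]_m) x i j : differentiable phi x ->
  ('J phi x) i j = partial i (fun y => phi y 0 j) x.
Proof.
move=> dphi; rewrite /jacobian mxE -deriveE// derive_mx ?mxE//.
exact: diff_derivable.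
Qed.

Lemma C1per_coord m (phi : 'rV[R]_n -> 'rV[R]_m) j :
  C1per phi -> C1s (fun x => phi x 0 j).
Proof.
move=> [dphi cphi zphi]; split.
- move=> x; apply: (@differentiable_comp _ _ _ _ phi (fun v : 'rV[R]_m => v 0 j)) => //.
  exact: differentiable_coord.
- move=> i; rewrite (_ : partial _ _ = fun x => ('J phi x) i j).
    move=> x; apply: (@continuous_comp _ _ _ (jacobian phi) (fun M : 'M[R]_(n, m) => M i j)).
      exact: cphi.
    exact: coord_continuous.
  by apply/funext => x; rewrite jacobianE.
- by move=> k x; rewrite zphi.
Qed.

Lemma coord_C1per m (phi : 'rV[R]_n -> 'rV[R]_m) :
  (forall j, C1s (fun x => phi x 0 j)) -> C1per phi.
Proof.
move=> cphi.
have dphi x : differentiable phi x.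
  rewrite (_ : phi = \sum_(j < m) (fun x => phi x 0 j *: delta_mx 0 j)).
    apply: differentiable_sum => j; apply: differentiableZl.
    by have [+ _ _] := cphi j; exact.
  by apply/funext => y; rewrite fct_sumE -row_sum_delta.
split => //.
- pose J i j y := 'J phi y i j.
  have cJ i j : continuous (J i j).
    have -> : J i j = partial i (fun y => phi y 0 j).
      by apply/funext => y; rewrite -jacobianE.
    by have [_ + _] := cphi j; exact.
  suff S x (e : R) : 0 < e -> \forall y \near nbhs x, ball ('J phi x) e ('J phi y).
    by move=> x; exact: ((@cvg_ballP _ _ _ (nbhs x) _ (jacobian phi) ('J phi x)).2 (S x)).
  move=> e0.
  have H i j : \forall y \near x, ball (J i j x) e (J i j y).
    exact: ((@cvg_ballP _ _ _ (nbhs x) _ (J i j) (J i j x)).1 (cJ i j x) e e0).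
  have H' i : \forall y \near x, forall j, ball (J i j x) e (J i j y).
    exact: (filter_forall (nbhs_filter x) (H i)).
  have H'' : \forall y \near x, forall i j, ball (J i j x) e (J i j y).
    exact: (filter_forall (nbhs_filter x) H').
  by apply: (@filterS _ _ (nbhs_filter x) _ _ _ H'') => y Hy; split => //; exact: Hy.
- by move=> k x; apply/rowP => j; have [_ _ /(_ k x)] := cphi j.
Qed.

Lemma divE (phi : 'rV[R]_n -> 'rV[R]_n) x : (forall x, differentiable phi x) ->
  div phi x = \sum_i partial i (fun y => phi y 0 i) x.
Proof. by move=> dphi; rewrite /div /mxtrace; apply: eq_bigr => i _; exact: jacobianE. Qed.

Lemma div_bounded (phi : 'rV[R]_n -> 'rV[R]_n) : C1per phi ->
  exists2 M : R, 0 <= M & forall x, `|div phi x| <= M.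
Proof.
move=> cphi.
have H i : {M : R | 0 <= M & forall x, `|partial i (fun y => phi y 0 i) x| <= M}.
  by apply: cid2; exact/partial_bounded/C1per_coord.
exists (\sum_i s2val (H i)); first by apply: sumr_ge0 => i _; exact: (s2valP (H i)).
move=> x; rewrite divE; last by case: cphi.
apply: le_trans (ler_norm_sum _ _ _) _; apply: ler_sum => i _.
exact: (s2valP' (H i)).
Qed.

Lemma measurable_div (phi : 'rV[R]_n -> 'rV[R]_n) : C1per phi ->
  measurable_fun setT (div phi).
Proof.
move=> cphi; rewrite (_ : div phi = fun x => \sum_i partial i (fun y => phi y 0 i) x).
  by apply: measurable_sum => i; apply: measurable_partial; exact: C1per_coord.
by apply/funext => x; rewrite divE//; case: cphi.
Qed.

Lemma continuous_div (phi : 'rV[R]_n -> 'rV[R]_n) : C1per phi ->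
  continuous (div phi).
Proof.
move=> cphi; rewrite (_ : div phi = fun x => \sum_i partial i (fun y => phi y 0 i) x).
  elim: (index_enum _) => [|i s IH].
    by under eq_fun do rewrite big_nil; exact: cst_continuous.
  under eq_fun do rewrite big_cons.
  have [_ /(_ i) cpd _] := C1per_coord i cphi.
  by move=> x; exact: (cvgD (cpd x) (IH x)).
by apply/funext => x; rewrite divE//; case: cphi.
Qed.

Lemma bounded_partial_integrable i (f : 'rV[R]_n -> R) : C1s f ->
  (leb n).-integrable Q (EFin \o partial i f).
Proof.
move=> cf; have [M _ HM] := partial_bounded i cf.
exact: bounded_integrable_Q (measurable_partial i cf) HM.
Qed.

(** On the torus there is no boundary, hence no boundary term. *)
Lemma integral_divergence (phi : 'rV[R]_n -> 'rV[R]_n) : C1per phi ->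
  (\int[leb n]_(x in Q) (div phi x)%:E = 0)%E.
Proof.
move=> cphi.
have [dphi _ _] := cphi.
under eq_integral do rewrite (divE _ dphi) -sumEFin.
rewrite integral_sum//; first last.
- by move=> i; exact/bounded_partial_integrable/C1per_coord.
- exact: measurable_Q.
by rewrite big1// => i _; exact/integral_partial/C1per_coord.
Qed.

End fields.

(** * Variation and energy *)

Section energy.
Context {R : realType} {n : nat}.
Implicit Types (u h : 'rV[R]_n -> R) (f : 'rV[R]_n -> 'rV[R]_n) (c K T : R).

Definition L1 u := (leb n).-integrable Q (EFin \o u).

Definition intQ u : R := \int[leb n]_(x in Q) u x.

Lemma L1_mulr u h M : L1 u -> measurable_fun setT h -> (forall x, `|h x| <= M) ->
  L1 (fun x => u x * h x).
Proof.
move=> iu mh hM.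
have /integrableP[/measurable_EFinP mu _] := iu.
apply: (@le_integrable _ _ _ _ _ (measurable_Q) _ (fun x => (M * u x)%:E)).
- apply/measurable_EFinP; apply: measurable_funM => //.
  exact: measurable_funTS.
- move=> x _; rewrite !abse_EFin lee_fin !normrM mulrC.
  rewrite ler_wpM2r// (le_trans (hM x))//; exact: ler_norm.
- by apply: (@integrableZl _ _ _ _ _ measurable_Q M (EFin \o u)).
Qed.

Lemma EFin_intQ u : L1 u -> (\int[leb n]_(x in Q) (u x)%:E)%E = (intQ u)%:E.
Proof. by move=> iu; rewrite fineK//; apply: integrable_fin_num => //; exact: measurable_Q. Qed.

Lemma intQD u v : L1 u -> L1 v -> intQ (fun x => u x + v x) = intQ u + intQ v.
Proof. by move=> iu iv; apply: RintegralD => //; exact: measurable_Q. Qed.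

Lemma intQB u v : L1 u -> L1 v -> intQ (fun x => u x - v x) = intQ u - intQ v.
Proof. by move=> iu iv; apply: RintegralB => //; exact: measurable_Q. Qed.

Lemma intQZ c u : L1 u -> intQ (fun x => c * u x) = c * intQ u.
Proof. by move=> iu; apply: RintegralZl => //; exact: measurable_Q. Qed.

Lemma le_intQ u v : L1 u -> L1 v -> (forall x, Q x -> u x <= v x) -> intQ u <= intQ v.
Proof. by move=> iu iv uv; apply: le_Rintegral => //; exact: measurable_Q. Qed.

Lemma eq_intQ u v : (forall x, Q x -> u x = v x) -> intQ u = intQ v.
Proof. by move=> uv; apply: eq_Rintegral => x /set_mem; exact: uv. Qed.

Lemma L1D u v : L1 u -> L1 v -> L1 (fun x => u x + v x).
Proof. by move=> iu iv; apply: (integrableD measurable_Q iu iv). Qed.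

Lemma L1B u v : L1 u -> L1 v -> L1 (fun x => u x - v x).
Proof. by move=> iu iv; apply: (integrableB measurable_Q iu iv). Qed.

Lemma L1Z c u : L1 u -> L1 (fun x => c * u x).
Proof. by move=> iu; apply: (integrableZl measurable_Q c iu). Qed.

Lemma L1_norm u : L1 u -> L1 (fun x => `|u x|).
Proof. exact: (@integrable_norm _ _ _ _ Q u). Qed.

Lemma L1_cst c : L1 (fun=> c).
Proof. exact: (@bounded_integrable_Q _ _ _ `|c|). Qed.

Lemma intQ_cst c : intQ (fun=> c) = c.
Proof. by rewrite /intQ (Rintegral_cst _ measurable_Q) [fine _](congr1 fine (@leb_Q R n)) mulr1. Qed.

Lemma le_norm_intQ u : L1 u -> `|intQ u| <= intQ (fun x => `|u x|).
Proof. by move=> iu; apply: le_normr_Rintegral => //; exact: measurable_Q. Qed.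

Lemma intQ_ge0 u : (forall x, Q x -> 0 <= u x) -> 0 <= intQ u.
Proof. exact: Rintegral_ge0. Qed.

Lemma L1_mul_div u f : L1 u -> C1per f -> L1 (fun x => u x * div f x).
Proof.
move=> iu cf; have [M _ HM] := div_bounded cf.
exact: L1_mulr iu (measurable_div cf) HM.
Qed.

Lemma L1_mul_C1s u h : L1 u -> C1s h -> L1 (fun x => u x * h x).
Proof.
move=> iu ch; have [M _ HM] := C1s_bounded ch.
exact: L1_mulr iu (measurable_C1s ch) HM.
Qed.

(** Bounds on suprema over test fields, kept as inequalities between reals.
    The first supremum is the variation of u; the second one is the energy
    of u, the total mass of the measure sqrt (|Du|^2 + (c u)^2), which is c
    times the supremum in the definition of F. *)
Definition TV_le u T := forall f, C1per f -> (forall x, sqnorm (f x) <= 1) ->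
  intQ (fun x => u x * div f x) <= T.

Definition energy_le c u K := forall f h, C1per f -> C1s h ->
  (forall x, sqnorm (f x) + h x ^+ 2 <= 1) ->
  intQ (fun x => u x * (div f x + c * h x)) <= K.

Lemma intQ_split c u f h : L1 u -> C1per f -> C1s h ->
  intQ (fun x => u x * (div f x + c * h x)) =
  intQ (fun x => u x * div f x) + c * intQ (fun x => u x * h x).
Proof.
move=> iu cf ch; rewrite -intQZ; last exact: L1_mul_C1s.
rewrite -intQD; last 2 first.
- exact: L1_mul_div.
- by apply: L1Z; exact: L1_mul_C1s.
by apply: eq_intQ => x _; ring.
Qed.

Lemma sqnorm_ge0 m (v : 'rV[R]_m) : 0 <= sqnorm v.
Proof. by apply: sumr_ge0 => i _; exact: sqr_ge0. Qed.

Lemma sqnormZ m a (v : 'rV[R]_m) : sqnorm (a *: v) = a ^+ 2 * sqnorm v.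
Proof. by rewrite /sqnorm mulr_sumr; apply: eq_bigr => i _; rewrite mxE exprMn. Qed.

Lemma C1perZ m a (phi : 'rV[R]_n -> 'rV[R]_m) : C1per phi -> C1per (fun x => a *: phi x).
Proof.
move=> cphi; apply: coord_C1per => j.
rewrite (_ : (fun _ => _) = fun x => a * phi x 0 j).
  by apply: C1sZ; exact: C1per_coord.
by apply/funext => x; rewrite mxE.
Qed.

Lemma divZ a f x : C1per f -> div (fun y => a *: f y) x = a * div f x.
Proof.
move=> cf; rewrite !divE; last 2 first.
- by case: cf.
- by case: (C1perZ a cf).
rewrite mulr_sumr; apply: eq_bigr => i _.
rewrite -partialZ; last exact: C1per_coord.
by congr (partial i _ x); apply/funext => y; rewrite mxE.
Qed.

Lemma C1per0 m : C1per (fun=> 0 : 'rV[R]_m) (n := n).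
Proof.
apply: coord_C1per => j; rewrite (_ : (fun _ => _) = fun=> 0); first exact: C1s_cst.
by apply/funext => x; rewrite mxE.
Qed.

Lemma div0 x : div (fun=> 0 : 'rV[R]_n) x = 0.
Proof.
have := divZ 0 x (C1per0 n); rewrite mul0r => <-; congr (div _ x).
by apply/funext => y; rewrite scale0r.
Qed.

Lemma TV_le_ge0 u T : TV_le u T -> 0 <= T.
Proof.
move=> /(_ _ (C1per0 n)) H; apply: le_trans (H _); last first.
  by move=> x; rewrite /sqnorm big1// => i _; rewrite mxE expr0n.
by rewrite -(intQ_cst 0) le_eqVlt; apply/orP; left; apply/eqP/eq_intQ => x _; rewrite div0 mulr0.
Qed.

Lemma energy_le_TV_le c u K : energy_le c u K -> TV_le u K.
Proof.
move=> J f cf f1; apply: le_trans (J f (fun=> 0) cf (C1s_cst 0) _).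
  by rewrite le_eqVlt; apply/orP; left; apply/eqP/eq_intQ => x _; rewrite mulr0 addr0.
by move=> x; rewrite expr0n/= addr0.
Qed.

Lemma energy_le_mass c u K : L1 u -> energy_le c u K -> c * intQ u <= K.
Proof.
move=> iu J; apply: le_trans (J (fun=> 0) (fun=> 1) (C1per0 n) (C1s_cst 1) _).
  rewrite -intQZ// le_eqVlt; apply/orP; left; apply/eqP/eq_intQ => x _.
  by rewrite div0 add0r mulr1 mulrC.
by move=> x; rewrite /sqnorm big1 ?expr1n ?add0r// => i _; rewrite mxE expr0n.
Qed.

Lemma test_normr_le1 f h : (forall x, sqnorm (f x) + h x ^+ 2 <= 1) ->
  forall x, `|h x| <= 1.
Proof.
move=> fh x; rewrite -(@ler_pXn2r _ 2)// ?nnegrE// expr1n real_normK ?num_real//.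
by have := fh x; have := sqnorm_ge0 (f x); lra.
Qed.

Lemma test_sqnorm_le1 f h : (forall x, sqnorm (f x) + h x ^+ 2 <= 1) ->
  forall x, sqnorm (f x) <= 1.
Proof. by move=> fh x; have := fh x; have := sqr_ge0 (h x); lra. Qed.

Lemma intQ_mul_le_mass u h : L1 u -> (forall x, Q x -> 0 <= u x) -> C1s h ->
  (forall x, `|h x| <= 1) -> `|intQ (fun x => u x * h x)| <= intQ u.
Proof.
move=> iu u0 ch h1.
apply: le_trans (le_norm_intQ (L1_mul_C1s iu ch)) _.
apply: le_intQ => // [|x Qx]; first exact/L1_norm/L1_mul_C1s.
by rewrite normrM (ger0_norm (u0 x Qx)) ler_piMr// u0.
Qed.

(** The test functional depends on c through c h, and h is at most 1. *)
Lemma energy_le_shift c c' u K : L1 u -> (forall x, Q x -> 0 <= u x) -> energy_le c u K ->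
  energy_le c' u (K + `|c' - c| * intQ u).
Proof.
move=> iu u0 J f h cf ch fh.
have := J f h cf ch fh; rewrite !intQ_split//.
have := intQ_mul_le_mass iu u0 ch (test_normr_le1 fh).
set A := intQ _; set B := intQ _ => BA.
have : (c' - c) * A <= `|c' - c| * B.
  by rewrite (le_trans (ler_norm _))// normrM ler_wpM2l.
lra.
Qed.

Lemma TV_le_energy_le c u T : L1 u -> (forall x, Q x -> 0 <= u x) -> 0 <= c ->
  TV_le u T -> energy_le c u (T + c * intQ u).
Proof.
move=> iu u0 c0 TV f h cf ch fh; rewrite intQ_split//.
apply: lerD; first exact: (TV f cf (test_sqnorm_le1 fh)).
apply: ler_wpM2l => //; apply: le_trans (ler_norm _) _.
exact: intQ_mul_le_mass iu u0 ch (test_normr_le1 fh).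
Qed.

(** Shrinking the last component of a test field by c' / c keeps it
    admissible. *)
Lemma energy_le_mono c c' u K : 0 <= c' <= c -> 0 < c -> energy_le c u K -> energy_le c' u K.
Proof.
move=> /andP[c'0 c'c] c0 J f h cf ch fh.
apply: le_trans (J f (fun x => (c' / c) * h x) cf (C1sZ _ ch) _).
  rewrite le_eqVlt; apply/orP; left; apply/eqP/eq_intQ => x _.
  by field; exact: lt0r_neq0.
move=> x; apply: le_trans (fh x); rewrite lerD2l exprMn ler_piMl ?sqr_ge0//.
rewrite expr_le1 ?divr_ge0 ?(ltW c0)//.
by rewrite ler_pdivrMr// mul1r.
Qed.

Lemma energy_leZ c u K t : L1 u -> 0 <= t -> energy_le c u K -> energy_le c (fun x => t * u x) (t * K).
Proof.
move=> iu t0 J f h cf ch fh.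
have -> : intQ (fun x => t * u x * (div f x + c * h x)) =
          t * intQ (fun x => u x * (div f x + c * h x)).
  rewrite -intQZ; first by apply: eq_intQ => x _; ring.
  have H := L1D (L1_mul_div iu cf) (L1_mul_C1s iu (C1sZ c ch)).
  rewrite /L1 [EFin \o _](_ : _ = EFin \o (fun x => u x * div f x + u x * (c * h x)))//.
  by apply/funext => x /=; congr EFin; ring.
by apply: ler_wpM2l => //; exact: J.
Qed.

(** For a constant density the divergence integrates to zero and only the last
    component of the field contributes. *)
Lemma energy_le_cst1 c : 0 <= c -> energy_le c (fun=> 1) c.
Proof.
move=> c0 f h cf ch fh; rewrite intQ_split//; last exact: L1_cst.
have -> : intQ (fun x => 1 * div f x) = 0.
  rewrite (_ : intQ _ = intQ (div f)); last by apply: eq_intQ => x _; rewrite mul1r.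
  by rewrite /intQ /Rintegral integral_divergence.
rewrite add0r -[leRHS]mulr1; apply: ler_wpM2l => //.
apply: le_trans (ler_norm _) _; rewrite -[leRHS](intQ_cst 1).
by apply: intQ_mul_le_mass ch (test_normr_le1 fh) => //; exact: L1_cst.
Qed.

Lemma energy_le_tilt c u K a b f : L1 u -> energy_le c u K -> a ^+ 2 + b ^+ 2 = 1 ->
  C1per f -> (forall x, sqnorm (f x) <= 1) ->
  a * intQ (fun x => u x * div f x) + c * (b * intQ u) <= K.
Proof.
move=> iu J ab cf f1.
apply: le_trans (J (fun x => a *: f x) (fun=> b) (C1perZ a cf) (C1s_cst b) _).
  rewrite (intQ_split c iu (C1perZ a cf) (C1s_cst b)).
  rewrite -(intQZ a (L1_mul_div iu cf)) -(intQZ b iu) lerD//.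
    by rewrite le_eqVlt; apply/orP; left; apply/eqP/eq_intQ => x _; rewrite (divZ _ _ cf) mulrCA.
  by rewrite le_eqVlt; apply/orP; left; apply/eqP; congr (_ * _); apply: eq_intQ => x _; rewrite mulrC.
by move=> x; rewrite sqnormZ -[leRHS]ab lerD2r ler_piMr ?sqr_ge0.
Qed.

(** Tilting a field f for the variation towards the last component, by the
    angle with cosine a and sine b. *)
(** The best tilt gives K >= sqrt (T^2 + (c m)^2) > T, where T is the variation
    and m the mass of u.  A small angle is enough: it costs the variation a
    second order term and gains a first order one. *)
Lemma energy_le_TV_lt c u K : L1 u -> 0 < c -> 0 < intQ u -> energy_le c u K ->
  exists2 T, TV_le u T & T < K.
Proof.
move=> iu c0 m0 J; set m := intQ u in m0 *.
have K0 : 0 < K by apply: lt_le_trans (energy_le_mass iu J); exact: mulr_gt0.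
have cm : 0 < c * m by exact: mulr_gt0.
(* s is the tangent of half of the angle, which keeps sine and cosine rational;
   it makes the loss, at most 2 s^2 K, smaller than half of the gain 2 s c m *)
pose s := c * m / (2 * K + 1).
have s0 : 0 < s by rewrite divr_gt0//; lra.
have sK : s * (2 * K) < c * m.
  by rewrite /s mulrAC ltr_pdivrMr ?ltr_pM2l//; lra.
have D0 : 0 < 1 + s ^+ 2 by have := sqr_ge0 s; lra.
pose co := (1 - s ^+ 2) / (1 + s ^+ 2); pose si := 2 * s / (1 + s ^+ 2).
have cosi : co ^+ 2 + si ^+ 2 = 1 by rewrite /co /si; field; exact: lt0r_neq0.
exists (K - s * (c * m) / (1 + s ^+ 2)).
  move=> f cf f1; have A := energy_le_tilt iu J cosi cf f1.
  rewrite -/m in A.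
  set I := intQ _ in A *.
  have IK : I <= K by exact: (energy_le_TV_le J cf f1).
  have {}A : (1 - s ^+ 2) * I + 2 * s * (c * m) <= K * (1 + s ^+ 2).
    rewrite -ler_pdivrMr//; apply: le_trans A.
    by rewrite le_eqVlt; apply/orP; left; apply/eqP; rewrite /co /si; field; exact: lt0r_neq0.
  have B : (I - K) * (1 + s ^+ 2) <= - (s * (c * m)).
    have s2 : s ^+ 2 * I <= s ^+ 2 * K by rewrite ler_wpM2l// sqr_ge0.
    have : s * (s * (2 * K)) <= s * (c * m) by rewrite ler_wpM2l ?ltW.
    by move: s2 A; rewrite !expr2; lra.
  rewrite -[leLHS](mulfK (lt0r_neq0 D0)) ler_pdivrMr// mulrBl divfK ?lt0r_neq0//.
  lra.
by rewrite ltrBlDr ltrDl divr_gt0// mulr_gt0.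
Qed.

(** The energy is convex in c, and by energy_le_TV_lt it lies strictly above the
    variation, its value at c = 0; so it strictly decreases with c. *)
Lemma energy_le_strict c c' u K : L1 u -> 0 < intQ u -> 0 < c' < c -> energy_le c u K ->
  exists2 K', energy_le c' u K' & K' < K.
Proof.
move=> iu m0 /andP[c'0 c'c] J.
have c0 : 0 < c by exact: lt_trans c'c.
have [T TV TK] := energy_le_TV_lt iu c0 m0 J.
exists ((c' / c) * K + (1 - c' / c) * T).
  move=> f h cf ch fh.
  have A := J f h cf ch fh; have B := TV f cf (test_sqnorm_le1 fh).
  move: A; rewrite !intQ_split//; move: B; set X := intQ _; set Y := intQ _ => B A.
  have l0 : 0 <= c' / c by rewrite divr_ge0// ltW.
  have l1 : 0 <= 1 - c' / c by rewrite subr_ge0 ler_pdivrMr// mul1r ltW.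
  have -> : X + c' * Y = c' / c * (X + c * Y) + (1 - c' / c) * X.
    by field; exact: lt0r_neq0.
  by apply: lerD; apply: ler_wpM2l.
rewrite -subr_gt0 (_ : K - _ = (1 - c' / c) * (K - T)); last by ring.
by rewrite mulr_gt0 ?subr_gt0// ltr_pdivrMr// mul1r.
Qed.

End energy.

(** * A binary digit as a limit of smooth functions *)

Section binary_digit.
Context {R : realType}.
Implicit Types (t : R) (m : nat).

Definition ang t : R := t * pi *+ 2.

(** The first binary digit of the fractional part of t (see bit_unit), written
    with the angle 2 pi t so that it is visibly periodic.  The clause on the
    cosine settles the points where the sine vanishes. *)
Definition bit t : bool :=
  (sin (ang t) < 0) || ((sin (ang t) == 0) && (cos (ang t) < 0)).

(** A sigmoid of a trigonometric polynomial.  For large m the sine decides, and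
    where it vanishes the cosine does: the limit is the digit at every point,
    without exceptional set. *)
Definition smooth_bit m t : R :=
  (1 + expR (m%:R ^+ 2 * sin (ang t) + m%:R * cos (ang t)))^-1.

Lemma angD1 t : ang (t + 1) = ang t + pi *+ 2.
Proof. by rewrite /ang mulrDl mul1r mulrnDl. Qed.

Lemma ang_half t : ang (t + 2^-1) = ang t + pi.
Proof. by rewrite /ang mulrDl mulrnDl; congr (_ + _); rewrite -mulr_natr; field. Qed.

Lemma bitD1 t : bit (t + 1) = bit t.
Proof. by rewrite /bit angD1 sinD2pi cosD2pi. Qed.

Lemma bitDnat t m : bit (t + m%:R) = bit t.
Proof.
elim: m => [|m IH]; first by rewrite addr0.
by rewrite -natr1 addrA bitD1.
Qed.

Lemma bit_half t : bit (t + 2^-1) = ~~ bit t.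
Proof.
rewrite /bit ang_half sinDpi cosDpi !oppr_lt0 oppr_eq0.
have := cos2Dsin2 (ang t); set s := sin _; set c := cos _ => sc.
case: (ltgtP s 0) => //= s0; case: (ltgtP c 0) => //= c0.
by move: sc; rewrite s0 c0 expr0n/= addr0 => /eqP; rewrite eq_sym oner_eq0.
Qed.

Lemma smooth_bitD1 m t : smooth_bit m (t + 1) = smooth_bit m t.
Proof. by rewrite /smooth_bit angD1 sinD2pi cosD2pi. Qed.

Lemma smooth_bitDnat m t k : smooth_bit m (t + k%:R) = smooth_bit m t.
Proof.
elim: k => [|k IH]; first by rewrite addr0.
by rewrite -natr1 addrA smooth_bitD1.
Qed.

Lemma smooth_bit_itv m t : 0 <= smooth_bit m t <= 1.
Proof.
have e0 := expR_gt0 (m%:R ^+ 2 * sin (ang t) + m%:R * cos (ang t)).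
apply/andP; split; first by rewrite invr_ge0 addr_ge0// ltW.
by rewrite invf_le1 ?addr_gt0// lerDl ltW.
Qed.

Lemma bit_unit t : 0 <= t < 1 -> bit t = (2^-1 <= t).
Proof.
have lo s : 0 <= s < 2^-1 -> bit s = false.
  move=> /andP[s0 s1].
  have a0 : 0 <= ang s <= pi.
    rewrite /ang -mulr_natr mulr_ge0 ?mulr_ge0 ?pi_ge0//=.
    by rewrite mulrAC ger_pMl ?pi_gt0//; lra.
  rewrite /bit ltNge sin_ge0_pi//=; apply/negP => /andP[/eqP sin0].
  have [s00|sn0] := eqVneq s 0.
    by rewrite s00 /ang mul0r mul0rn cos0 ltr10.
  suff : 0 < sin (ang s) by rewrite sin0 ltxx.
  have sp : 0 < s by rewrite lt_def sn0.
  apply: sin_gt0_pi; rewrite /ang -mulr_natr; apply/andP; split.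
    by rewrite !mulr_gt0// pi_gt0.
  by rewrite mulrAC gtr_pMl ?pi_gt0//; lra.
move=> /andP[t0 t1]; case: leP => [th|th]; last by rewrite lo// t0.
by rewrite -[t](subrK 2^-1) bit_half lo// subr_ge0 th/=; lra.
Qed.

Lemma cvg_quadratic_pinfty (y z : R) : 0 < y \/ (y = 0 /\ 0 < z) ->
  (m%:R * (m%:R * y + z)) @[m --> \oo] --> +oo.
Proof.
move=> H.
have [c c0 near_c] : exists2 c, 0 < c & \forall m \near \oo, c <= m%:R * y + z.
  case: H => [y0|[-> z0]]; last by exists z => //; near=> m; rewrite mulr0 add0r.
  exists 1 => //; near=> m; rewrite -lerBlDr -ler_pdivrMr//.
  near: m; exact: nbhs_infty_ger.
apply/cvgryPge => A; near=> m.
have mA : `|A| / c <= m%:R by near: m; exact: nbhs_infty_ger.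
rewrite (le_trans (ler_norm A))// (@le_trans _ _ (m%:R * c))//.
  by rewrite -ler_pdivrMr.
by rewrite ler_wpM2l//; near: m.
Unshelve. all: by end_near.
Qed.

Lemma cvg_smooth_bit t : smooth_bit m t @[m --> \oo] --> ((bit t)%:R : R).
Proof.
pose y := sin (ang t); pose z := cos (ang t).
have E m : m%:R ^+ 2 * y + m%:R * z = m%:R * (m%:R * y + z) by ring.
have one : y < 0 \/ (y = 0 /\ z < 0) ->
    (1 + expR (m%:R * (m%:R * y + z)))^-1 @[m --> \oo] --> (1 : R).
  move=> H; have c : (m%:R * (m%:R * (- y) + - z)) @[m --> \oo] --> +oo.
    apply: cvg_quadratic_pinfty.
    by rewrite !oppr_gt0; case: H => [|[-> ?]]; [left|right; rewrite oppr0].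
  have A : (1 + expR (m%:R * (m%:R * y + z))) @[m --> \oo] --> (1 + 0 : R).
    apply: cvgD; first exact: cvg_cst.
    have := cvg_comp _ _ c (@cvgr_expR R); apply: cvg_trans.
    apply: near_eq_cvg; apply: nearW => m /=; congr expR; ring.
  rewrite addr0 in A.
  have := cvgV (oner_neq0 R) A; rewrite invr1; exact.
have zero : 0 < y \/ (y = 0 /\ 0 < z) ->
    (1 + expR (m%:R * (m%:R * y + z)))^-1 @[m --> \oo] --> (0 : R).
  move=> H; have := cvg_comp _ _ (cvg_quadratic_pinfty H) (@cvgr_expR R).
  apply: squeeze_cvgr (cvg_cst _); apply: nearW => m /=.
  apply/andP; split; first by rewrite invr_ge0 addr_ge0// expR_ge0.
  have e0 := expR_gt0 (m%:R * (m%:R * y + z)).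
  rewrite expRN lef_pV2 ?posrE ?addr_gt0//.
  by rewrite lerDr.
rewrite /smooth_bit /bit -/y -/z; under eq_fun do rewrite E.
have [y0|y0|y0] := ltgtP y 0.
- by apply: one; left.
- by apply: zero; left.
rewrite /=; have [z0|z0|z0] := ltgtP z 0.
- by apply: one; right.
- by apply: zero; right.
have := cos2Dsin2 (ang t); rewrite -/y -/z y0 z0 expr0n/= addr0 => /eqP.
by rewrite eq_sym oner_eq0.
Qed.

Let A m c (s : R) := m%:R ^+ 2 * sin (ang (c * s)) + m%:R * cos (ang (c * s)).

Let dA m c (s : R) := m%:R ^+ 2 * (cos (ang (c * s)) * (c * pi *+ 2))
  + m%:R * (- sin (ang (c * s)) * (c * pi *+ 2)).

Let is_derive_ang c (s : R) : is_derive s 1 (fun s => ang (c * s)) (c * pi *+ 2).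
Proof.
rewrite (_ : (fun _ => _) = (fun s => (c * pi *+ 2) * s)); last first.
  by apply/funext => x; rewrite /ang; ring.
have := is_deriveZ (c * pi *+ 2) (is_derive_id s (1 : R)).
by rewrite [_%:A]mulr1.
Qed.

Let is_derive_A m c (s : R) : is_derive s 1 (A m c) (dA m c s).
Proof.
have H1 := @is_derive1_comp _ sin (fun s => ang (c * s)) s _ _ (is_derive_sin (ang (c * s))) (is_derive_ang c s).
have H2 := @is_derive1_comp _ cos (fun s => ang (c * s)) s _ _ (is_derive_cos (ang (c * s))) (is_derive_ang c s).
exact: (is_deriveD (is_deriveZ (m%:R ^+ 2) H1) (is_deriveZ (m%:R) H2)).
Qed.

Let dB m c (s : R) := - (smooth_bit m (c * s)) ^+ 2 * (expR (A m c s) * dA m c s).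

Let is_derive_B m c (s : R) :
  is_derive s 1 (fun s => smooth_bit m (c * s)) (dB m c s).
Proof.
have H1 := @is_derive1_comp _ expR (A m c) s _ _ (is_derive_expR (A m c s)) (is_derive_A m c s).
have H2 := is_deriveD (is_derive_cst (1 : R) s (1 : R)) H1.
have n0 : 1 + expR (A m c s) != 0 by rewrite gt_eqF// addr_gt0// expR_gt0.
have H := @is_deriveV _ (fun s => 1 + expR (A m c s)) s _ 1 n0 H2.
by rewrite add0r -exprVn in H.
Qed.

Lemma derivable_smooth_bit m (c : R) t :
  derivable (fun s => smooth_bit m (c * s)) t 1.
Proof. by apply: ex_derive; exact: is_derive_B. Qed.

Let is_derive_continuous (f df : R -> R) : (forall s : R, is_derive s (1 : R) f (df s)) -> continuous f.
Proof.
move=> H s; apply: differentiable_continuous; apply/derivable1_diffP.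
by apply: ex_derive; exact: H.
Qed.

Lemma continuous_derive_smooth_bit m (c : R) :
  continuous (fun s => smooth_bit m (c * s))^`()%classic.
Proof.
rewrite (_ : _^`()%classic = dB m c); last first.
  by apply/funext => s; rewrite derive1E; apply: derive_val; exact: is_derive_B.
have cang := is_derive_continuous (is_derive_ang c).
have cA := is_derive_continuous (is_derive_A m c).
have cB := is_derive_continuous (is_derive_B m c).
have csin : continuous (fun s : R => sin (ang (c * s))).
  by move=> s; apply: (@continuous_comp _ _ _ (fun s => ang (c * s)) sin); [exact: cang|exact: continuous_sin].
have ccos : continuous (fun s : R => cos (ang (c * s))).
  by move=> s; apply: (@continuous_comp _ _ _ (fun s => ang (c * s)) cos); [exact: cang|exact: continuous_cos].
have cexp : continuous (fun s : R => expR (A m c s)).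
  by move=> s; apply: (@continuous_comp _ _ _ (A m c) expR); [exact: cA|exact: continuous_expR].
move=> s; apply: cvgM.
  by apply: cvgN; rewrite expr2; exact: (cvgM (cB s) (cB s)).
apply: cvgM; first exact: cexp.
apply: cvgD; (apply: cvgM; first exact: cvg_cst); (apply: cvgM; last exact: cvg_cst).
  exact: ccos.
by apply: cvgN; exact: csin.
Qed.

End binary_digit.

(** * The variation controls translations *)

Section translation.
Context {R : realType}.

(** By the mean value theorem on each step, the derivative being uniformly
    continuous. *)
Lemma riemann_cvg (F f : R -> R) (h : R) : (forall s : R, is_derive s (1 : R) F (f s)) ->
  continuous f -> 0 < h ->
  (h / k.+1%:R * \sum_(r < k.+1) f (- (r%:R * (h / k.+1%:R)))) @[k --> \oo]
    --> F 0 - F (- h).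
Proof.
move=> dF cf h0; apply/cvgrPdist_le => e e0.
have [d d0 Hd] := compact_uniform_continuous (@segment_compact R (- h) 0) cf (divr_gt0 e0 h0).
have cF : continuous F.
  move=> s; apply: differentiable_continuous; apply/derivable1_diffP.
  by apply: ex_derive; exact: dF.
near=> k.
set eta := h / k.+1%:R.
have k0 : (0 : R) < k.+1%:R by rewrite ltr0n.
have eta0 : 0 < eta by exact: divr_gt0.
have eta_d : eta < d.
  rewrite /eta ltr_pdivrMr// mulrC -ltr_pdivrMr//.
  apply: (@lt_trans _ _ k%:R); last by rewrite ltr_nat.
  by near: k; exact: nbhs_infty_gtr.
have tel K : F 0 - F (- (K%:R * eta)) =
    \sum_(r < K) (F (- (r%:R * eta)) - F (- (r.+1%:R * eta))).
  elim: K => [|K IH]; first by rewrite big_ord0 mul0r oppr0 subrr.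
  by rewrite big_ord_recr/= -IH addrA subrK.
have -> : F 0 - F (- h) = F 0 - F (- (k.+1%:R * eta)).
  by rewrite /eta mulrC divfK// gt_eqF.
rewrite tel mulr_sumr -sumrB (le_trans (ler_norm_sum _ _ _))//.
apply: (@le_trans _ _ (\sum_(r < k.+1) (eta * (e / h)))); last first.
  rewrite sumr_const card_ord -mulr_natl /eta.
  by rewrite le_eqVlt; apply/orP; left; apply/eqP; field; rewrite !gt_eqF.
apply: ler_sum => r _.
have lt_r : - (r.+1%:R * eta) <= - (r%:R * eta).
  by rewrite lerN2; apply: ler_wpM2r; [exact: ltW|rewrite ler_nat].
have [c] := @MVT_segment R F f _ _ lt_r (fun x _ => dF x) (continuous_subspaceT cF).
rewrite in_itv/= => /andP[c1 c2] ->.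
have -> : - (r%:R * eta) - - (r.+1%:R * eta) = eta by rewrite -natr1; ring.
rewrite (mulrC (f c)) -mulrBr normrM gtr0_norm//; apply: ler_wpM2l; first exact: ltW.
rewrite distrC; apply: ltW; apply: Hd.
  rewrite /= in_itv/= oppr_le0; apply/andP; split; last by rewrite mulr_ge0// ltW.
  rewrite lerN2 -[leRHS](divfK (lt0r_neq0 k0)) mulrC; apply: ler_wpM2l; first exact: ltW.
  by rewrite ler_nat ltnW.
rewrite /ball/= ger0_norm ?subr_ge0//.
apply: le_lt_trans eta_d; rewrite lerBlDr.
move: c1; rewrite -natr1; lra.
Unshelve. all: by end_near.
Qed.

Lemma norm_avg_le k (a : nat -> R) M : (forall r, `|a r| <= M) ->
  `|k.+1%:R^-1 * \sum_(r < k.+1) a r| <= M.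
Proof.
move=> aM; rewrite normrM ger0_norm ?invr_ge0// mulrC ler_pdivrMr ?ltr0n//.
rewrite (le_trans (ler_norm_sum _ _ _))//.
rewrite mulr_natr -[in leRHS](card_ord k.+1) -sumr_const.
by apply: ler_sum => r _; exact: aM.
Qed.

Context {n : nat}.
Implicit Types (u w : 'rV[R]_n -> R).

Lemma cvg_intQ_dominated (f_ : nat -> 'rV[R]_n -> R) (f G : 'rV[R]_n -> R) :
  (forall k, measurable_fun Q (f_ k)) -> measurable_fun Q f -> L1 G ->
  (forall k x, Q x -> `|f_ k x| <= G x) ->
  (forall x, Q x -> f_ k x @[k --> \oo] --> f x) ->
  L1 f /\ intQ (f_ k) @[k --> \oo] --> intQ f.
Proof.
move=> mf_ mf iG fG ff.
have mQ := @measurable_Q R n.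
have A k : L1 (f_ k).
  apply: (le_integrable mQ _ _ iG); first exact/measurable_EFinP.
  move=> x Qx; rewrite !abse_EFin lee_fin (le_trans (fG k x Qx))//.
  exact: ler_norm.
have [|||||ig _ cv] := @dominated_convergence _ _ R (leb n) Q mQ
  (fun k x => (f_ k x)%:E) (fun x => (f x)%:E) (fun x => (G x)%:E).
- by move=> k; exact/measurable_EFinP.
- exact/measurable_EFinP.
- apply: aeW => x Qx; apply: cvg_EFin; first exact: nearW.
  exact: ff.
- exact: iG.
- by apply: aeW => x k Qx; rewrite abse_EFin lee_fin; exact: fG.
split; first exact: ig.
have E : (fun k => (\int[leb n]_(x in Q) (f_ k x)%:E)%E) = (fun k => (intQ (f_ k))%:E).
  by apply/funext => k; rewrite EFin_intQ.
move: cv; rewrite E (EFin_intQ ig); exact: fine_cvg.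
Qed.

Lemma cvg_intQ u (g_ : nat -> 'rV[R]_n -> R) (g : 'rV[R]_n -> R) M : L1 u ->
  (forall k, measurable_fun setT (g_ k)) -> measurable_fun setT g ->
  (forall k x, `|g_ k x| <= M) ->
  (forall x, Q x -> g_ k x @[k --> \oo] --> g x) ->
  intQ (fun x => u x * g_ k x) @[k --> \oo] --> intQ (fun x => u x * g x).
Proof.
move=> iu mg_ mg gM gg.
have /integrableP[/measurable_EFinP mu _] := iu.
apply: (cvg_intQ_dominated (G := fun x => M * `|u x|) _ _ _ _ _).2.
- by move=> k; apply: measurable_funM => //; exact: measurable_funTS.
- by apply: measurable_funM => //; exact: measurable_funTS.
- exact: (L1Z M (L1_norm iu)).
- by move=> k x _; rewrite normrM mulrC ler_wpM2r.
- by move=> x Qx; apply: cvgM; [exact: cvg_cst|exact: gg].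
Qed.

(** The test field is the average of w over finitely many points on the segment
    from x to x - h e_i.  Its divergence is a Riemann sum for the difference of
    w at the two ends, divided by h; and unlike an integral over the segment it
    is visibly of class C^1. *)
Lemma TV_translate u w i (h T : R) : L1 u -> TV_le u T -> C1s w -> (forall x, `|w x| <= 1) ->
  0 < h -> intQ (fun x => u x * (w x - w (x - h *: delta_mx 0 i))) <= h * T.
Proof.
move=> iu TV cw w1 h0.
have [M M0 HM] := partial_bounded i cw.
pose e : 'rV[R]_n := delta_mx 0 i.
pose sh (k r : nat) (x : 'rV[R]_n) := w (x - (r%:R * (h / k.+1%:R)) *: e).
have csh k r : C1s (sh k r) by exact: C1s_shift.
pose avg k x := k.+1%:R^-1 * \sum_(r < k.+1) sh k r x.
have cavg k : C1s (avg k) by apply: C1sZ; exact: C1s_sum.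
pose davg k x := k.+1%:R^-1 * \sum_(r < k.+1) partial i w (x - (r%:R * (h / k.+1%:R)) *: e).
have pdavg k x : partial i (avg k) x = davg k x.
  rewrite /avg partialZ; last exact: C1s_sum.
  by rewrite partial_sum//; congr (_ * _); apply: eq_bigr => r _; exact: partial_shift.
have avg1 k x : `|avg k x| <= 1.
  by apply: (@norm_avg_le k (fun r => sh k r x)) => r; exact: w1.
have davgM k x : `|davg k x| <= M.
  by apply: (@norm_avg_le k (fun r => partial i w (x - (r%:R * (h / k.+1%:R)) *: e))) => r; exact: HM.
have mdavg k : measurable_fun setT (davg k).
  by rewrite (_ : davg k = partial i (avg k)); [exact: measurable_partial|apply/funext => x; rewrite pdavg].
pose fld k x : 'rV[R]_n := avg k x *: e.
have fldE k j : (fun x => fld k x 0 j) = fun x => (i == j)%:R * avg k x.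
  by apply/funext => x; rewrite !mxE eqxx/= mulrC eq_sym.
have cfld k : C1per (fld k).
  by apply: coord_C1per => j; rewrite fldE; exact: C1sZ.
have divfld k x : div (fld k) x = davg k x.
  have [dfld _ _] := cfld k.
  rewrite (divE _ dfld) (bigD1 i)//= fldE eqxx partialZ// mul1r pdavg big1 ?addr0//.
  by move=> j ji; rewrite fldE eq_sym (negbTE ji) partialZ// mul0r.
have fld1 k x : sqnorm (fld k x) <= 1.
  rewrite /fld sqnormZ (_ : sqnorm e = 1) ?mulr1.
    by rewrite -(expr1n _ 2) -real_normK ?num_real// ler_pXn2r ?nnegrE.
  rewrite /sqnorm (bigD1 i)//= mxE !eqxx/= expr1n big1 ?addr0// => j ji.
  by rewrite mxE eqxx/= (negbTE ji) expr0n.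
have le k : intQ (fun x => u x * davg k x) <= T.
  have := TV _ (cfld k) (fld1 k); congr (_ <= _); apply: eq_intQ => x _.
  by rewrite divfld.
have cv : intQ (fun x => u x * davg k x) @[k --> \oo] -->
          intQ (fun x => u x * ((w x - w (x - h *: e)) / h)).
  apply: (cvg_intQ (M := M)) => //.
    apply: measurable_funM => //; apply: measurable_funB; apply: measurable_C1s => //.
    exact: C1s_shift.
  move=> x _.
  have := @riemann_cvg (fun s => w (x + s *: e)) (fun s => partial i w (x + s *: e)) h
    (fun s => is_derive_line i x s cw) _ h0.
  have cpd : continuous (fun s : R => partial i w (x + s *: e)).
    have [_ /(_ i) cpd _] := cw; move=> s.
    apply: (@continuous_comp _ _ _ (fun s : R => x + s *: e) (partial i w)) (cpd _).
    by apply: cvgD; [exact: cvg_cst|exact: scalel_continuous].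
  move=> /(_ cpd); rewrite scale0r addr0 scaleNr => C.
  rewrite (_ : (fun k => davg k x) = fun k => h / k.+1%:R *
     (\sum_(r < k.+1) partial i w (x + - (r%:R * (h / k.+1%:R)) *: e)) * h^-1).
    by apply: cvgM; [exact: C|exact: cvg_cst].
  have hK (a b : R) : h * a * b / h = a * b by field; rewrite gt_eqF.
  apply/funext => k; rewrite hK; congr (_ * _); apply: eq_bigr => r _; by rewrite scaleNr.
have : intQ (fun x => u x * ((w x - w (x - h *: e)) / h)) <= T.
  by apply: (cvgr_to_le cv); exact: nearW.
have iw : L1 (fun x => u x * (w x - w (x - h *: e))).
  rewrite (_ : (fun _ => _) = fun x => u x * w x - u x * w (x - h *: e)).
    by apply: L1B; apply: L1_mul_C1s => //; exact: C1s_shift.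
  by apply/funext => x; rewrite mulrBr.
rewrite -ler_pdivrMl// -intQZ//; congr (_ <= _); apply: eq_intQ => x _; ring.
Qed.

End translation.

(** * Dyadic cells *)

Section binary_expansion.
Context {R : realType}.
Implicit Types (s t : R) (j l : nat).

Definition shift_bit t : R := 2 * t - (bit t)%:R.

Lemma shift_bit_unit t : 0 <= t < 1 -> 0 <= shift_bit t < 1.
Proof.
move=> t01; have := bit_unit t01; move: t01; rewrite /shift_bit => /andP[t0 t1] ->.
by case: (lerP 2^-1 t) => /= th; lra.
Qed.

Lemma bit_exp2D t (b : bool) l : bit (2 ^+ l * (t + b%:R)) = bit (2 ^+ l * t).
Proof. by rewrite mulrDr -natrX -natrM bitDnat. Qed.

Lemma bit_shift_bit l t : bit (2 ^+ l.+1 * t) = bit (2 ^+ l * shift_bit t).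
Proof.
by rewrite -[RHS](bit_exp2D _ (bit t)) /shift_bit subrK exprSr mulrA.
Qed.

(** If the digit of weight 2^-(j+1) is one, subtracting this weight clears it
    without a borrow, so the earlier digits are unchanged. *)
Lemma bit_borrow j t : 0 <= t < 1 -> bit (2 ^+ j * t) ->
  2^-1 ^+ j.+1 <= t /\
  forall l, (l < j)%N -> bit (2 ^+ l * (t - 2^-1 ^+ j.+1)) = bit (2 ^+ l * t).
Proof.
elim: j t => [|j IH] t t01.
  by rewrite expr0 mul1r bit_unit// expr1.
rewrite bit_shift_bit => bt.
have s01 := shift_bit_unit t01.
have [le_s IHl] := IH _ s01 bt.
set d := 2^-1 ^+ j.+1 in le_s IHl *.
have d0 : 0 < d by rewrite exprn_gt0// invr_gt0.
have dE : 2^-1 ^+ j.+2 = d / 2 by rewrite exprSr.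
have b01 : 0 <= ((bit t)%:R : R) <= 1 by case: (bit t); rewrite /= ?lexx ?ler01.
have tE : t = (shift_bit t + (bit t)%:R) / 2 by rewrite /shift_bit; field.
move: s01 => /andP[s0 s1].
have td : d / 2 <= t by rewrite [leRHS]tE; move: b01 => /andP[b0 b1]; lra.
rewrite dE; split => // l lj.
have bE : bit (t - d / 2) = bit t.
  have t'01 : 0 <= t - d / 2 < 1 by move: t01 => /andP[? ?]; lra.
  rewrite (bit_unit t'01) (bit_unit t01).
  have := bit_unit t01; case: (bit t) tE => /= tE.
    by move=> /esym H; rewrite H; lra.
  by move=> /esym H; rewrite H; lra.
case: l lj => [|l] lj; first by rewrite !expr0 !mul1r.
rewrite !bit_shift_bit -IHl//; congr (bit (_ * _)).
by rewrite /shift_bit bE; field.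
Qed.

Lemma bit_separates j s t : 0 <= s < 1 -> 0 <= t < 1 ->
  (forall l, (l < j)%N -> bit (2 ^+ l * s) = bit (2 ^+ l * t)) ->
  `|s - t| < 2^-1 ^+ j.
Proof.
elim: j s t => [|j IH] s t s01 t01 H.
  rewrite expr0 ltr_norml; move: s01 t01 => /andP[? ?] /andP[? ?]; lra.
have b0 : bit s = bit t by have := H 0%N isT; rewrite !expr0 !mul1r.
have := IH _ _ (shift_bit_unit s01) (shift_bit_unit t01).
have -> : shift_bit s - shift_bit t = 2 * (s - t) by rewrite /shift_bit b0; ring.
rewrite normrM gtr0_norm// exprS ltr_pdivlMl//; apply.
by move=> l lj; rewrite -!bit_shift_bit H.
Qed.

End binary_expansion.

Section words.
Context {R : realType} {n : nat} (hn : (0 < n)%N).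
Implicit Types (x : 'rV[R]_n) (a : seq bool -> R) (T : nat) (u : 'rV[R]_n -> R).

(** The digits of the coordinates are read in turn: the T-th digit of a point is
    the digit number T / n of its coordinate number T mod n.  A word of length T
    thus names a cell of the cube, and the next digit cuts the cell into two
    halves. *)
Definition bit_dir T : 'I_n := Ordinal (ltn_pmod T hn).
Definition bit_level T : nat := (T %/ n)%N.

Definition bitx T x : bool := bit (2 ^+ bit_level T * x 0 (bit_dir T)).
Definition bits T x : seq bool := mkseq (fun s => bitx s x) T.

Definition sbit m T x : R := smooth_bit m (2 ^+ bit_level T * x 0 (bit_dir T)).

(** A smooth version of a (bits T x).  It is a convex combination of values of
    a, so that it keeps their bounds. *)
Fixpoint smooth_word m T a x : R :=
  if T is T'.+1 then
    (1 - sbit m T' x) * smooth_word m T' (fun w => a (rcons w false)) x +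
    sbit m T' x * smooth_word m T' (fun w => a (rcons w true)) x
  else a [::].

Lemma bitsS T x : bits T.+1 x = rcons (bits T x) (bitx T x).
Proof. exact: mkseqS. Qed.

Lemma size_bits T x : size (bits T x) = T.
Proof. exact: size_mkseq. Qed.

Lemma C1s_sbit m T : C1s (sbit m T).
Proof.
apply: (@C1s_coord _ _ (fun t => smooth_bit m (2 ^+ bit_level T * t))) => [t||t].
  exact: derivable_smooth_bit.
  exact: continuous_derive_smooth_bit.
by rewrite mulrDr mulr1 -[X in _ + X]natrX smooth_bitDnat.
Qed.

Lemma C1s_smooth_word m T a : C1s (smooth_word m T a).
Proof.
elim: T a => [|T IH] a; first exact: C1s_cst.
apply: C1sD; apply: C1sM => //; last exact: C1s_sbit.
rewrite (_ : (fun _ => _) = fun x => 1 + (-1) * sbit m T x).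
  by apply: C1sD; [exact: C1s_cst|apply: C1sZ; exact: C1s_sbit].
by apply/funext => x; rewrite mulN1r.
Qed.

Lemma smooth_word_le m T a (M : R) x : (forall w, `|a w| <= M) -> `|smooth_word m T a x| <= M.
Proof.
elim: T a => [|T IH] a aM /=; first exact: aM.
have /andP[s0 s1] : 0 <= sbit m T x <= 1 by exact: smooth_bit_itv.
have A := IH (fun w => a (rcons w false)) (fun w => aM _).
have B := IH (fun w => a (rcons w true)) (fun w => aM _).
rewrite (le_trans (ler_normD _ _))// !normrM.
rewrite (ger0_norm s0) ger0_norm ?subr_ge0//.
rewrite [leRHS](_ : _ = (1 - sbit m T x) * M + sbit m T x * M); last by ring.
by apply: lerD; apply: ler_wpM2l => //; rewrite subr_ge0.
Qed.

Lemma cvg_smooth_word T a x : smooth_word m T a x @[m --> \oo] --> a (bits T x).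
Proof.
elim: T a => [|T IH] a; first exact: cvg_cst.
have cb : sbit m T x @[m --> \oo] --> ((bitx T x)%:R : R) by exact: cvg_smooth_bit.
have := cvgD (cvgM (cvgB (cvg_cst (1 : R)) cb) (IH (fun w => a (rcons w false))))
             (cvgM cb (IH (fun w => a (rcons w true)))).
rewrite bitsS; case: (bitx T x) => /=.
  by rewrite subrr mul0r add0r mul1r; apply.
by rewrite subr0 mul0r addr0 mul1r; apply.
Qed.

Lemma measurable_bits T a : measurable_fun setT (fun x => a (bits T x)).
Proof.
apply: (@measurable_fun_cvg _ _ _ _ (fun m => smooth_word m T a)).
  by move=> m; apply: measurable_C1s; exact: C1s_smooth_word.
by move=> x _; exact: cvg_smooth_word.
Qed.

Lemma measurable_bitx T : measurable_fun setT (fun x => (bitx T x)%:R : R).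
Proof.
have := measurable_bits T.+1 (fun w => (last false w)%:R).
by under eq_fun do rewrite bitsS last_rcons.
Qed.

Lemma take_bits T k x : (T <= k)%N -> take T (bits k x) = bits T x.
Proof. by move=> Tk; rewrite /bits /mkseq -map_take take_iota (minn_idPl Tk). Qed.

Lemma bits_bounded T a : exists M, forall x, `|a (bits T x)| <= M.
Proof.
elim: T a => [|T IH] a; first by exists `|a [::]|.
have [M0 H0] := IH (fun w => a (rcons w false)).
have [M1 H1] := IH (fun w => a (rcons w true)).
exists (Num.max M0 M1) => x; rewrite bitsS le_max.
by case: (bitx T x); rewrite ?H0 ?H1 ?orbT.
Qed.

Definition halfstep T : R := 2^-1 ^+ (bit_level T).+1.

Lemma bitx_half T x : bitx T (x - halfstep T *: delta_mx 0 (bit_dir T)) = ~~ bitx T x.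
Proof.
rewrite /bitx !mxE !eqxx mulr1 mulrBr /halfstep exprSr mulrA -exprMn.
rewrite divff ?pnatr_eq0// expr1n mul1r.
by rewrite -[in RHS](subrK 2^-1 (2 ^+ bit_level T * _)) bit_half negbK.
Qed.

Lemma bits_half T x : Q x -> bitx T x ->
  bits T (x - halfstep T *: delta_mx 0 (bit_dir T)) = bits T x.
Proof.
move=> Qx bT; apply/eq_in_map => s; rewrite mem_iota add0n => /= sT.
rewrite /bitx !mxE eqxx /=; have [ds|ds] := eqVneq (bit_dir s) (bit_dir T); last first.
  by rewrite mulr0 subr0.
rewrite ds mulr1; apply: (bit_borrow (j := bit_level T) _ bT).2.
  by have /andP[x0 x1] := Qx (bit_dir T); rewrite ltW.
have /(congr1 val) /= mod_eq := ds.
rewrite ltnNge; apply/negP => le.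
have : (T <= s)%N by rewrite (divn_eq T n) (divn_eq s n) mod_eq leq_add2r leq_mul2r le orbT.
by rewrite leqNgt sT.
Qed.

(** Translation by half of the width of a cell exchanges its two halves.  So the
    left hand side pairs u with the difference of w and its translate, where w
    is a (bits T x) on the lower halves and zero on the upper ones. *)
Lemma TV_halves u T V a : L1 u -> TV_le u V -> (forall w, `|a w| <= 1) ->
  intQ (fun x => u x * (a (bits T x) * (1 - 2 * (bitx T x)%:R))) <= halfstep T * V.
Proof.
move=> iu TV a1.
pose e : 'rV[R]_n := delta_mx 0 (bit_dir T).
have h0 : 0 < halfstep T by rewrite exprn_gt0// invr_gt0.
pose w m x := smooth_word m T a x * (1 + (-1) * sbit m T x).
have cs m : C1s (fun x => 1 + (-1) * sbit m T x).
  by apply: C1sD; [exact: C1s_cst|apply: C1sZ; exact: C1s_sbit].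
have cw m : C1s (w m) by apply: C1sM; [exact: C1s_smooth_word|exact: cs].
have w1 m x : `|w m x| <= 1.
  have /andP[s0 s1] : 0 <= sbit m T x <= 1 by exact: smooth_bit_itv.
  rewrite normrM mulr_ile1 ?normr_ge0 ?smooth_word_le//.
  by rewrite mulN1r ger0_norm ?subr_ge0// gerBl.
have le m : intQ (fun x => u x * (w m x - w m (x - halfstep T *: e))) <= halfstep T * V.
  exact: (TV_translate (bit_dir T) iu TV (cw m) (w1 m) h0).
have cv : intQ (fun x => u x * (w m x - w m (x - halfstep T *: e))) @[m --> \oo] -->
    intQ (fun x => u x * (a (bits T x) * (1 - 2 * (bitx T x)%:R))).
  apply: (cvg_intQ (M := 2)) => //.
  - move=> m; apply: measurable_funB; apply: measurable_C1s; first exact: cw.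
    by apply: (C1s_shift (halfstep T *: e) (cw m)).
  - apply: measurable_funM; first exact: measurable_bits.
    apply: measurable_funB => //; apply: measurable_funM => //; exact: measurable_bitx.
  - move=> m x; rewrite (le_trans (ler_normB _ _))// -[2]/(1 + 1).
    by apply: lerD; exact: w1.
  - move=> x Qx.
    have c y : w m y @[m --> \oo] --> a (bits T y) * (1 + (-1) * (bitx T y)%:R).
      apply: cvgM; first exact: cvg_smooth_word.
      apply: cvgD; first exact: cvg_cst.
      by apply: cvgM; [exact: cvg_cst|exact: cvg_smooth_bit].
    have cc : w m x - w m (x - halfstep T *: e) @[m --> \oo] -->
        a (bits T x) * (1 + (-1) * (bitx T x)%:R) -
        a (bits T (x - halfstep T *: e)) * (1 + (-1) * (bitx T (x - halfstep T *: e))%:R).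
      by apply: cvgB; exact: c.
    move: cc; rewrite bitx_half; have := @bits_half T x Qx.
    case: (bitx T x) => /= [-> //|_].
      rewrite !mulr1 !mulr0 subrr mulr0 sub0r addr0 mulr1.
      by rewrite (_ : 1 - 2 = -1 :> R) ?mulrN1//; ring.
    by rewrite !mulr0 !mulr1 !addr0 subrr mulr0 !subr0.
by apply: (cvgr_to_le cv); exact: nearW.
Qed.

End words.

(** * Completeness of L^1 *)

Section L1_completeness.
Context {R : realType} {n : nat}.
Variables (v : nat -> 'rV[R]_n -> R) (C : R).
Hypotheses (mv : forall k, measurable_fun setT (v k)) (iv : forall k, L1 (v k))
  (v0 : forall k x, 0 <= v k x).
Hypothesis vC : forall N, \sum_(k < N) intQ (fun x => `|v k.+1 x - v k x|) <= C.

(* G, the sum of the increments, is integrable.  On the set E where it is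
   finite the sequence converges and is dominated by v 0 + G; off E, a null set,
   it is replaced by 0, which makes it converge everywhere. *)
Let d k x := `|v k.+1 x - v k x|.
Let G x : \bar R := (\sum_(0 <= k <oo) (d k x)%:E)%E.
Let E : set 'rV[R]_n := [set x | G x \is a fin_num].

Let d0 k x : 0 <= d k x. Proof. exact: normr_ge0. Qed.

Let md k : measurable_fun setT (d k).
Proof. by apply: measurableT_comp => //; exact: measurable_funB. Qed.

Let G0 x : (0 <= G x)%E.
Proof. by apply: nneseries_ge0 => k _ _; rewrite lee_fin. Qed.

Let mG : measurable_fun setT G.
Proof.
apply: ge0_emeasurable_sum => [k x _ _|k _]; first by rewrite lee_fin.
exact/measurable_EFinP.
Qed.

Let Ld k : L1 (d k).
Proof. by apply: L1_norm; exact: L1B. Qed.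

Let intG : (\int[leb n]_(x in Q) G x <= C%:E)%E.
Proof.
rewrite integral_nneseries; last 3 first.
- exact: measurable_Q.
- by move=> k; apply: measurable_funTS; exact/measurable_EFinP.
- by move=> k x _; rewrite lee_fin.
apply: lime_le; first by apply: is_cvg_nneseries => k _ _; apply: integral_ge0 => x _; rewrite lee_fin.
apply: nearW => N; rewrite big_mkord.
under eq_bigr do rewrite (EFin_intQ (Ld _)).
by rewrite sumEFin lee_fin.
Qed.

Let iG : (leb n).-integrable Q G.
Proof.
apply/integrableP; split; first exact: measurable_funTS.
under eq_integral do rewrite gee0_abs//.
exact: le_lt_trans intG (ltry _).
Qed.

Let ifG : L1 (fine \o G).
Proof.
apply: (le_integrable measurable_Q _ _ iG).
  apply/measurable_EFinP; apply: measurable_funTS.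
  by apply: measurableT_comp => //; exact: fine_measurable.
move=> x _ /=; rewrite gee0_abs//; have := G0 x.
by case: (G x) => [r| |]//=; rewrite ?normr0 ?leey// lee_fin => r0; rewrite ger0_norm.
Qed.

Let mE : measurable E.
Proof. by have := emeasurable_fin_num measurableT mG; rewrite setTI. Qed.

Let v' k x := \1_E x * v k x.

Let tel k x : v k x = v 0%N x + series (fun j => v j.+1 x - v j x) k.
Proof. exact: (eq_sum_telescope (v^~ x) k). Qed.

Let v'_le k x : `|v' k x| <= v 0%N x + fine (G x).
Proof.
have fG0 : 0 <= fine (G x) by exact: fine_ge0.
rewrite /v' indicE; case: (boolP (x \in E)) => [/set_mem Ex|_] /=.
  rewrite mul1r tel; apply: le_trans (ler_normD _ _) _.
  rewrite ger0_norm// lerD2l /series/=; apply: le_trans (ler_norm_sum _ _ _) _.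
  rewrite -lee_fin fineK// -sumEFin.
  by apply: nneseries_lim_ge => j _ _; rewrite lee_fin.
by rewrite mul0r normr0 addr_ge0.
Qed.

Let cvg_v' x : cvgn (v'^~ x).
Proof.
rewrite /v' indicE; case: (boolP (x \in E)) => [/set_mem Ex|_] /=; last first.
  by under eq_fun do rewrite mul0r; exact: is_cvg_cst.
under eq_fun do rewrite mul1r tel.
apply: is_cvgD; first exact: is_cvg_cst.
apply: normed_cvg; apply: nnseries_is_cvg => // [k|]; first exact: normr_ge0.
by move: Ex; rewrite /E /= ge0_fin_numE.
Qed.

Let ae_v' : {ae leb n, forall x, Q x -> \1_E x = 1 :> R}.
Proof.
apply: filterS (integrable_ae measurable_Q iG) => x H Qx.
by rewrite indicE mem_set//; exact: H.
Qed.

(** Completeness of L^1 for sequences with summable increments, with convergence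
    stated against bounded functions. *)
Lemma L1_complete : exists u : 'rV[R]_n -> R, [/\ L1 u, forall x, 0 <= u x &
  forall (b : 'rV[R]_n -> R) (M : R), measurable_fun setT b -> (forall x, `|b x| <= M) ->
    intQ (fun x => v k x * b x) @[k --> \oo] --> intQ (fun x => u x * b x)].
Proof.
pose u x := limn (v'^~ x).
have cu x : v' k x @[k --> \oo] --> u x by exact: cvg_v'.
have mv' k : measurable_fun setT (v' k) by apply: measurable_funM.
have mu : measurable_fun setT u.
  by apply: (measurable_fun_cvg mv') => x _; exact: cu.
have iD : L1 (fun x => v 0%N x + fine (G x)) by exact: L1D.
have key (b : 'rV[R]_n -> R) (M : R) : measurable_fun setT b -> (forall x, `|b x| <= M) ->
    L1 (fun x => u x * b x) /\
    intQ (fun x => v' k x * b x) @[k --> \oo] --> intQ (fun x => u x * b x).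
  move=> mb bM.
  apply: (cvg_intQ_dominated (G := fun x => M * (v 0%N x + fine (G x)))).
  - by move=> k; apply: measurable_funTS; exact: measurable_funM.
  - by apply: measurable_funTS; exact: measurable_funM.
  - exact: L1Z.
  - by move=> k x _; rewrite normrM mulrC ler_pM.
  - by move=> x _; apply: cvgM; [exact: cu|exact: cvg_cst].
exists u; split.
- have [|iu1 _] := key (fun=> 1) 1 (measurable_cst _); first by move=> x; rewrite normr1.
  move: iu1; rewrite (_ : (fun _ => _) = u)//.
  by apply/funext => x; rewrite mulr1.
- move=> x; apply: (cvgr_to_ge (cu x)); apply: nearW => k.
  by rewrite mulr_ge0// indicE ler0n.
- move=> b M mb bM; have [_] := key b M mb bM.
  rewrite (_ : (fun k => intQ (fun x => v' k x * b x)) = (fun k => intQ (fun x => v k x * b x)))//.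
  apply/funext => k; congr fine; apply: ae_eq_integral.
  - exact: measurable_Q.
  - by apply/measurable_EFinP; apply: measurable_funTS; exact: measurable_funM.
  - by apply/measurable_EFinP; apply: measurable_funTS; exact: measurable_funM.
  - by apply: filterS ae_v' => x H Qx; rewrite /v' H// mul1r.
Qed.

End L1_completeness.

(** * Masses of dyadic cells *)

Section word_sums.
Context {R : realType}.
Implicit Types (F G : seq bool -> R) (T : nat).

(** The sum of F over the words of length T, arranged so that one more letter
    is a computation rule. *)
Fixpoint wsum T F : R :=
  if T is T'.+1 then wsum T' (fun w => F (rcons w false) + F (rcons w true))
  else F [::].

Lemma eq_wsum T F G : (forall w, size w = T -> F w = G w) -> wsum T F = wsum T G.
Proof.
elim: T F G => [|T IH] F G H /=; first exact: H.
by apply: IH => w wT; rewrite !H ?size_rcons ?wT.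
Qed.

Lemma wsumZ T c F : wsum T (fun w => c * F w) = c * wsum T F.
Proof.
elim: T F => [//|T IH] F /=; rewrite -IH; apply: eq_wsum => w _; ring.
Qed.

Lemma wsum0 T F : (forall w, size w = T -> 0 <= F w) -> wsum T F <= 0 ->
  forall w, size w = T -> F w = 0.
Proof.
elim: T F => [|T IH] F F0 /= S0 w.
  by move=> /size0nil ->; apply/eqP; rewrite eq_le S0 F0.
case/lastP: w => [//|w b]; rewrite size_rcons => -[wT].
have F0' w' b' : size w' = T -> 0 <= F (rcons w' b').
  by move=> w'T; apply: F0; rewrite size_rcons w'T.
have := IH (fun w => F (rcons w false) + F (rcons w true))
  (fun w' w'T => addr_ge0 (F0' w' false w'T) (F0' w' true w'T)) S0 w wT.
by have := F0' w false wT; have := F0' w true wT; case: b; lra.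
Qed.

Lemma cvg_wsum (T : nat) (I : Type) (A : set_system I) {FA : Filter A}
    (F : I -> seq bool -> R) (l : seq bool -> R) :
  (forall w, F i w @[i --> A] --> l w) -> wsum T (F i) @[i --> A] --> wsum T l.
Proof.
elim: T F l => [|T IH] F l H /=; first exact: H.
by apply: IH => w; apply: cvgD; exact: H.
Qed.

End word_sums.

Section masses.
Context {R : realType} {n : nat} (hn : (0 < n)%N).
Implicit Types (u : 'rV[R]_n -> R) (a : seq bool -> R) (w : seq bool) (T : nat).
Local Notation bits := (bits hn).
Local Notation bitx := (bitx hn).

Lemma bits_wsum T a (x : 'rV[R]_n) : a (bits T x) = wsum T (fun w => a w * (bits T x == w)%:R).
Proof.
elim: T a => [|T IH] a; first by rewrite /= mulr1.
rewrite bitsS (IH (fun w => a (rcons w (bitx T x)))) /=.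
apply: eq_wsum => w _; rewrite !eqseq_rcons.
by case: (bitx T x); rewrite ?andbT ?andbF mulr0 ?addr0 ?add0r.
Qed.

Definition mass u w : R := intQ (fun x => u x * (bits (size w) x == w)%:R).

Lemma L1_mul_bits u T a : L1 u -> L1 (fun x => u x * a (bits T x)).
Proof.
move=> iu.
have [M HM] := bits_bounded hn T a.
exact: (L1_mulr iu (measurable_bits hn T a) HM).
Qed.

Lemma intQ_wsum T (F : seq bool -> 'rV[R]_n -> R) : (forall w, L1 (F w)) ->
  intQ (fun x => wsum T (fun w => F w x)) = wsum T (fun w => intQ (F w)).
Proof.
elim: T F => [//|T IH] F iF /=.
rewrite IH; last by move=> w; exact: L1D.
by apply: eq_wsum => w _; rewrite intQD.
Qed.

Lemma intQ_bits u T a : L1 u ->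
  intQ (fun x => u x * a (bits T x)) = wsum T (fun w => a w * mass u w).
Proof.
move=> iu.
have iw w : L1 (fun x => u x * (bits T x == w)%:R).
  exact: (L1_mul_bits T (fun v => (v == w)%:R) iu).
transitivity (intQ (fun x => wsum T (fun w => a w * (u x * (bits T x == w)%:R)))).
  apply: eq_intQ => x _; rewrite bits_wsum -wsumZ; apply: eq_wsum => w _; ring.
rewrite intQ_wsum; last by move=> w; exact: L1Z.
by apply: eq_wsum => w wT; rewrite intQZ// /mass wT.
Qed.

Lemma mass_ge0 u w : (forall x, Q x -> 0 <= u x) -> 0 <= mass u w.
Proof. by move=> u0; apply: intQ_ge0 => x Qx; rewrite mulr_ge0// u0. Qed.

Lemma mass_nil u : mass u [::] = intQ u.
Proof. by apply: eq_intQ => x _; rewrite /= mulr1. Qed.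

Lemma mass_rcons u w : L1 u -> mass u w = mass u (rcons w false) + mass u (rcons w true).
Proof.
move=> iu.
have H b : L1 (fun x => u x * (bits (size (rcons w b)) x == rcons w b)%:R).
  exact: (L1_mul_bits _ (fun v => (v == rcons w b)%:R) iu).
rewrite /mass -intQD//; apply: eq_intQ => x _.
rewrite !size_rcons -mulrDr bitsS !eqseq_rcons; congr (_ * _).
by case: (bitx _ x); rewrite ?andbT ?andbF ?addr0 ?add0r.
Qed.

Lemma mass_le u w : L1 u -> (forall x, Q x -> 0 <= u x) -> mass u w <= intQ u.
Proof.
move=> iu u0; apply: le_intQ => //.
  exact: (L1_mul_bits _ (fun v => (v == w)%:R) iu).
by move=> x Qx; rewrite ler_piMr ?u0//; case: (_ == _).
Qed.

(** TV_halves for the signs of the differences: on the scale of the cells, a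
    density of bounded variation is nearly constant. *)
Lemma mass_halves u T V : L1 u -> TV_le u V ->
  wsum T (fun w => `|mass u (rcons w false) - mass u (rcons w true)|) <= @halfstep R n T * V.
Proof.
move=> iu TV.
pose a w := Num.sg (mass u (rcons w false) - mass u (rcons w true)).
have a1 w : `|a w| <= 1 by rewrite normr_sg; case: (_ != _).
apply: le_trans (TV_halves hn T iu TV a1).
pose a' w := a (take T w) * (1 - 2 * (last false w)%:R).
rewrite (_ : intQ _ = intQ (fun x => u x * a' (bits T.+1 x))); last first.
  apply: eq_intQ => x _; rewrite /a' bitsS last_rcons -cats1 take_size_cat//.
  by rewrite size_bits.
rewrite intQ_bits//= le_eqVlt; apply/orP; left; apply/eqP; apply: eq_wsum => w wT.
rewrite /a' !last_rcons -!cats1 !take_size_cat//= normrEsg /a -!cats1.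
ring.
Qed.

Lemma halfstep_gt0 T : 0 < @halfstep R n T.
Proof. by rewrite exprn_gt0// invr_gt0. Qed.

Lemma TV_le_cst1 : TV_le (fun=> 1 : R) 0 (n := n).
Proof. exact: energy_le_TV_le (energy_le_cst1 (lexx 0)). Qed.

(** The density 1 has variation zero, so mass_halves shows that both halves of a
    cell have the same measure. *)
Lemma mass_cst1 w : mass (fun=> 1) w = 2^-1 ^+ size w.
Proof.
elim/last_ind: w => [|w b IH]; first by rewrite mass_nil intQ_cst.
have i1 := @L1_cst R n 1.
have := mass_halves (size w) i1 TV_le_cst1; rewrite mulr0 => S0.
have eq01 : mass (fun=> 1) (rcons w false) = mass (fun=> 1) (rcons w true).
  apply/eqP; rewrite -subr_eq0 -normr_eq0; apply/eqP.
  exact: (wsum0 (fun w' _ => normr_ge0 _) S0 erefl).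
move: IH; rewrite (mass_rcons w i1) size_rcons exprSr => H.
by case: b; lra.
Qed.

End masses.

(** * Densities from masses *)

Lemma ultra_fmap (S T : Type) (f : S -> T) (A : set_system S) :
  UltraFilter A -> UltraFilter (f @ A).
Proof.
move=> UA; split => [|B PB AB]; first exact: fmap_proper_filter.
apply/seteqP; split => // X BX; rewrite /fmap /=.
have [//|AnX] := in_ultra_setVsetC (f @^-1` X) UA.
have BnX : B (~` X) by apply: AB.
exfalso; have := @filter_not_empty _ B _; apply.
by rewrite -(setICr X); exact: filterI.
Qed.

Lemma ultra_bounded_cvg {R : realType} (T : Type) (A : set_system T) (f : T -> R) (b : R) :
  UltraFilter A -> (forall t, 0 <= f t <= b) -> exists l : R, f @ A --> l.
Proof.
move=> UA fb.
have := @segment_compact R 0 b; rewrite compact_ultra => /(_ (f @ A) (ultra_fmap f UA)).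
case=> [|l [_ fl]]; last by exists l.
rewrite /fmap /= (_ : _ @^-1` _ = setT); first exact: filterT.
by apply/seteqP; split => // t _ /=; rewrite in_itv/=; exact: fb.
Qed.

Section compactness.
Context {R : realType} {n : nat} (hn : (0 < n)%N).
Implicit Types (a : seq bool -> R) (w : seq bool) (T : nat).
Local Notation bits := (bits hn).
Local Notation bitx := (bitx hn).
Local Notation mass := (mass hn).

Lemma sum_halfstep_block J : \sum_(0 <= k < J * n) @halfstep R n k = n%:R * (1 - 2^-1 ^+ J).
Proof.
elim: J => [|J IH]; first by rewrite mul0n big_nil subrr mulr0.
rewrite mulSn addnC (@big_cat_nat _ _ _ (J * n)%N) ?leq_addr//= IH.
rewrite -{1}[(J * n)%N]add0n big_addn addKn.
rewrite (eq_big_nat _ _ (F2 := fun=> 2^-1 ^+ J.+1)).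
  by rewrite sumr_const_nat subn0 -mulr_natl exprS; field.
move=> k /andP[_ kn]; rewrite /halfstep /bit_level divnDr ?dvdn_mull//.
by rewrite divn_small// mulnK.
Qed.

(** There are n digits per level, and the widths 2^-(J+1) sum to 1. *)
Lemma sum_halfstep N : \sum_(k < N) @halfstep R n k <= n%:R.
Proof.
apply: (@le_trans _ _ (\sum_(0 <= k < N * n) @halfstep R n k)).
  rewrite -(big_mkord xpredT) [leRHS](@big_cat_nat _ _ _ N) ?leq_pmulr//= lerDl.
  by apply: sumr_ge0 => k _; apply: ltW; exact: halfstep_gt0.
rewrite sum_halfstep_block ler_piMr// gerBl exprn_ge0// invr_ge0//.
Qed.

(** The densities v T, constant on the cells of level T, form a martingale.  One
    step changes the density by the difference of the masses of the two halves,
    so the increments are summable in L^1, and the limit has the prescribed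
    masses. *)
Lemma martingale_limit (m : seq bool -> R) V : (forall w, 0 <= m w) ->
  (forall w, m w = m (rcons w false) + m (rcons w true)) ->
  (forall T, wsum T (fun w => `|m (rcons w false) - m (rcons w true)|) <= @halfstep R n T * V) ->
  exists u : 'rV[R]_n -> R, [/\ L1 u, forall x, 0 <= u x &
    forall T a, intQ (fun x => u x * a (bits T x)) = wsum T (fun w => a w * m w)].
Proof.
move=> m0 mD mV.
have i1 := @L1_cst R n 1.
have L1b T a : L1 (fun x : 'rV[R]_n => a (bits T x)).
  have := L1_mul_bits hn T a i1.
  by rewrite (_ : (fun _ => _) = fun x => a (bits T x))//; apply/funext => x; rewrite mul1r.
have IQb T a : intQ (fun x : 'rV[R]_n => a (bits T x)) = wsum T (fun w => a w * 2^-1 ^+ T).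
  transitivity (intQ (fun x : 'rV[R]_n => 1 * a (bits T x))).
    by apply: eq_intQ => x _; rewrite mul1r.
  by rewrite (intQ_bits hn)//; apply: eq_wsum => w wT; rewrite mass_cst1 wT.
pose v T (x : 'rV[R]_n) := 2 ^+ T * m (bits T x).
have exp2V T : 2 ^+ T * 2^-1 ^+ T = 1 :> R by rewrite -exprMn divff ?expr1n.
have dv T x : `|v T.+1 x - v T x| =
    2 ^+ T * `|m (rcons (bits T x) false) - m (rcons (bits T x) true)|.
  rewrite /v bitsS (mD (bits T x)) exprS.
  set y := m (rcons _ false); set z := m (rcons _ true).
  have p0 : 0 <= 2 ^+ T :> R by rewrite exprn_ge0.
  case: (bitx T x); rewrite -/y -/z.
    rewrite (_ : _ - _ = 2 ^+ T * (z - y)); last by ring.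
    by rewrite normrM (ger0_norm p0) distrC.
  rewrite (_ : _ - _ = 2 ^+ T * (y - z)); last by ring.
  by rewrite normrM (ger0_norm p0).
have IQdv T : intQ (fun x => `|v T.+1 x - v T x|) <= @halfstep R n T * V.
  apply: le_trans (mV T).
  rewrite (_ : intQ _ = intQ (fun x : 'rV[R]_n => (fun w => 2 ^+ T * `|m (rcons w false) - m (rcons w true)|) (bits T x))).
    rewrite (IQb T (fun w => 2 ^+ T * `|m (rcons w false) - m (rcons w true)|)).
    rewrite le_eqVlt; apply/orP; left; apply/eqP; apply: eq_wsum => w _.
    by rewrite mulrAC exp2V mul1r.
  by apply: eq_intQ => x _; rewrite dv.
have V0 : 0 <= V.
  rewrite -(pmulr_rge0 _ (@halfstep_gt0 R n 0)); apply: le_trans (mV 0%N).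
  by rewrite /= normr_ge0.
have vC N : \sum_(T < N) intQ (fun x => `|v T.+1 x - v T x|) <= n%:R * V.
  apply: (@le_trans _ _ (\sum_(T < N) @halfstep R n T * V)).
    by apply: ler_sum => T _; exact: IQdv.
  by rewrite -mulr_suml ler_wpM2r// sum_halfstep.
have [u [iu u0 uv]] := @L1_complete R n v (n%:R * V)
  (fun T => measurable_bits hn T (fun w => 2 ^+ T * m w))
  (fun T => L1b T (fun w => 2 ^+ T * m w))
  (fun T x => mulr_ge0 (exprn_ge0 T (ler0n R 2)) (m0 _)) vC.
exists u; split => // T a.
have [M HM] := bits_bounded hn T a.
have C := uv _ M (measurable_bits hn T a) HM.
have cst k : (T <= k)%N -> intQ (fun x => v k x * a (bits T x)) = wsum T (fun w => a w * m w).
  move=> Tk.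
  rewrite (_ : intQ _ = intQ (fun x : 'rV[R]_n => (fun w => 2 ^+ k * m w * a (take T w)) (bits k x))); last first.
    by apply: eq_intQ => x _; rewrite take_bits.
  rewrite (IQb k (fun w => 2 ^+ k * m w * a (take T w))).
  transitivity (wsum k (fun w => a (take T w) * m w)).
    apply: eq_wsum => w _.
    have := exp2V k; move: (2 ^+ k) (2^-1 ^+ k) => p q pq.
    by rewrite -[RHS]mul1r -pq; ring.
  rewrite -(subnKC Tk); elim: (k - T)%N => [|j IH].
    by rewrite addn0; apply: eq_wsum => w wT; rewrite take_oversize ?wT.
  rewrite addnS /= -IH; apply: eq_wsum => w wT.
  by rewrite -!cats1 !takel_cat ?wT ?leq_addr// !cats1 -mulrDr -mD.
apply: (@cvg_unique _ (@norm_hausdorff _ _) _ _ _ _ C).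
apply: cvg_near_cst; near=> k; apply: cst; near: k; exact: nbhs_infty_ge.
Unshelve. all: by end_near.
Qed.

End compactness.

(** * Weak compactness *)

Section weak_compactness.
Context {R : realType} {n : nat} (hn : (0 < n)%N).
Local Notation bits := (bits hn).
Local Notation mass := (mass hn).

Lemma Q_unit (x : 'rV[R]_n) i : Q x -> 0 <= x 0 i < 1.
Proof. by move=> /(_ i) /andP[x0 x1]; rewrite ltW. Qed.

(** Cells of a high level are small, so a continuous function is uniformly
    close to one that is constant on cells. *)
Lemma bits_approx (W : 'rV[R]_n -> R) (e : R) : continuous W -> 0 < e ->
  exists T a, forall x, Q x -> `|W x - a (bits T x)| <= e.
Proof.
move=> cW e0.
have cK := @rV_compact R n (fun=> `[0, 1]%classic) (fun=> @segment_compact R 0 1).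
have [d d0 Hd] := compact_uniform_continuous cK cW e0.
have [J HJ] : exists J, 2^-1 ^+ J < d :> R.
  have : 2^-1 ^+ J @[J --> \oo] --> (0 : R).
    by apply: cvg_expr; rewrite ger0_norm ?invr_ge0// invf_lt1// ltr1n.
  move=> /cvgrPdist_lt/(_ d d0)[J _ /(_ J (leqnn J))].
  rewrite sub0r normrN ger0_norm; last by rewrite exprn_ge0// invr_ge0.
  by exists J.
exists (J * n)%N, (fun w => W (xget 0 [set y | Q y /\ bits (J * n) y = w])) => x Qx.
have [Qy bxy] := @xgetPex _ 0 [set y | Q y /\ bits (J * n) y = bits (J * n) x]
  (ex_intro _ x (conj Qx erefl)).
move: (xget _ _) Qy bxy => y Qy bxy.
apply/ltW; have := Hd x y _ _; rewrite /ball/=; apply.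
  by move=> i /=; rewrite in_itv/=; have /andP[-> /ltW ->] := Q_unit i Qx.
apply: rV_ballP => // i; apply: lt_trans HJ.
apply: bit_separates; [exact: Q_unit|exact: Q_unit|] => l lJ.
have lT : (l * n + i < J * n)%N.
  apply: (@leq_trans (l.+1 * n)); last by rewrite leq_mul2r lJ orbT.
  by rewrite mulSn addnC ltn_add2r.
have := congr1 (fun s => nth false s (l * n + i)) bxy.
rewrite !nth_mkseq// /bitx /bit_level /bit_dir.
have -> : Ordinal (ltn_pmod (l * n + i) hn) = i.
  by apply: val_inj => /=; rewrite modnMDl modn_small.
by rewrite divnMDl// divn_small// addn0.
Qed.

(** Weak compactness in BV.  The mass of every cell converges along an
    ultrafilter, which replaces the extraction of a diagonal subsequence.  The
    bound of mass_halves passes to the limit, so martingale_limit applies: a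
    bounded variation excludes concentration. *)
Lemma BV_compact (u_ : nat -> 'rV[R]_n -> R) (V : R) : (forall k, L1 (u_ k)) ->
  (forall k x, Q x -> 0 <= u_ k x) -> (forall k, intQ (u_ k) = 1) ->
  (forall k, TV_le (u_ k) V) ->
  exists (A : set_system nat) (u : 'rV[R]_n -> R), [/\ ProperFilter A, \oo `<=` A,
    L1 u, forall x, 0 <= u x &
    forall W M, continuous W -> (forall x, `|W x| <= M) ->
      intQ (fun x => u_ k x * W x) @[k --> A] --> intQ (fun x => u x * W x)].
Proof.
move=> iu u0 u1 TVu.
have [A [UA ooA]] := ultraFilterLemma (_ : ProperFilter \oo).
have PA : ProperFilter A by exact: ultra_proper.
have bd w k : 0 <= mass (u_ k) w <= 1.
  apply/andP; split; first exact: mass_ge0 (u0 k).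
  by rewrite -(u1 k); exact: mass_le (iu k) (u0 k).
have /choice[m mE] : forall w, exists l : R, mass (u_ k) w @[k --> A] --> l.
  by move=> w; apply: (ultra_bounded_cvg (b := 1) UA); exact: bd.
have m0 w : 0 <= m w.
  by apply: (cvgr_to_ge (mE w)); apply: nearW => k; have /andP[] := bd w k.
have mD w : m w = m (rcons w false) + m (rcons w true).
  have H : mass (u_ k) w @[k --> A] --> m (rcons w false) + m (rcons w true).
    under eq_fun do rewrite (mass_rcons hn w (iu _)).
    by apply: cvgD; exact: mE.
  exact: (@cvg_unique _ (@norm_hausdorff _ _) _ _ _ _ (mE w) H).
have mV T : wsum T (fun w => `|m (rcons w false) - m (rcons w true)|) <= @halfstep R n T * V.
  have H : wsum T (fun w => `|mass (u_ k) (rcons w false) - mass (u_ k) (rcons w true)|)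
      @[k --> A] --> wsum T (fun w => `|m (rcons w false) - m (rcons w true)|).
    by apply: cvg_wsum => w; apply: cvg_norm; apply: cvgB; exact: mE.
  by apply: (cvgr_to_le H); apply: nearW => k; exact: mass_halves.
have [u [Lu u_ge0 uE]] := martingale_limit hn m0 mD mV.
exists A, u; split => // W M cW WM.
have m1 : m [::] = 1.
  have H : mass (u_ k) [::] @[k --> A] --> (1 : R).
    by under eq_fun do rewrite mass_nil u1; exact: cvg_cst.
  exact: (@cvg_unique _ (@norm_hausdorff _ _) _ _ _ _ (mE [::]) H).
have Iu : intQ u = 1.
  have := uE 0%N (fun=> 1); rewrite /= mul1r m1 => <-.
  by apply: eq_intQ => x _; rewrite mulr1.
apply/cvgrPdist_le => e e0.
have e3 : 0 < e / 3 by exact: divr_gt0.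
have [T [a Ha]] := bits_approx cW e3.
have near_a f : L1 f -> (forall x, Q x -> 0 <= f x) -> intQ f = 1 ->
    `|intQ (fun x => f x * W x) - intQ (fun x => f x * a (bits T x))| <= e / 3.
  move=> Lf f0 f1.
  have LW : L1 (fun x => f x * W x) by exact: (L1_mulr Lf (continuous_measurable_rV cW) WM).
  have La : L1 (fun x => f x * a (bits T x)) by exact: L1_mul_bits.
  rewrite -intQB//; apply: le_trans (le_norm_intQ (L1B LW La)) _.
  rewrite (_ : e / 3 = intQ (fun x => e / 3 * f x)); last by rewrite intQZ// f1 mulr1.
  apply: le_intQ.
  - exact/L1_norm/L1B.
  - exact: L1Z.
  - move=> x Qx; rewrite -mulrBr normrM (ger0_norm (f0 x Qx)) mulrC.
    by apply: ler_wpM2r; [exact: f0|exact: Ha].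
have cT : intQ (fun x => u_ k x * a (bits T x)) @[k --> A] --> intQ (fun x => u x * a (bits T x)).
  rewrite uE; under eq_fun do rewrite (intQ_bits hn T a (iu _)).
  by apply: cvg_wsum => w; apply: cvgM; [exact: cvg_cst|exact: mE].
move/cvgrPdist_le : cT => /(_ _ e3) cT.
apply: (@filterS _ A _ _ _ _ cT) => k /= Hk.
have A1 := near_a u Lu (fun x _ => u_ge0 x) Iu.
have A2 := near_a (u_ k) (iu k) (u0 k) (u1 k).
move: A1 A2 Hk; set X1 := intQ _; set X2 := intQ _; set X3 := intQ _; set X4 := intQ _.
rewrite !ler_norml => /andP[? ?] /andP[? ?] /andP[? ?]; apply/andP; split; lra.
Qed.

End weak_compactness.

(** * The functional in terms of the energy *)

Section functional.
Context {R : realType} {n : nat}.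
Implicit Types (u g : 'rV[R]_n -> R) (c K T : R) (psi : 'rV[R]_n -> \bar R).

Lemma TVper_leP u T : L1 u -> (TVper u <= T%:E)%E <-> TV_le u T.
Proof.
move=> iu; split => [H f cf f1|H].
  rewrite -lee_fin -EFin_intQ; last exact: L1_mul_div.
  by apply: le_trans H; apply: ereal_sup_ubound; exists f.
apply: ge_ereal_sup => _ [f [cf f1] <-].
by rewrite EFin_intQ; [rewrite lee_fin; exact: H|exact: L1_mul_div].
Qed.

Lemma TVper_ge0 u : (0 <= TVper u)%E.
Proof.
apply: ereal_sup_ubound; exists (fun=> 0).
  split; first exact: C1per0.
  by move=> x; rewrite /sqnorm big1// => i _; rewrite mxE expr0n.
by apply: integral0_eq => x _; rewrite div0 mulr0.
Qed.

Lemma BVperP u : BVper u <-> L1 u /\ exists T, TV_le u T.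
Proof.
split => [[iu TV]|[iu [T TV]]]; split => //.
  exists (fine (TVper u)); apply/(TVper_leP _ iu).
  by rewrite fineK// ge0_fin_numE// TVper_ge0.
by apply: le_lt_trans (ltry T); apply/(TVper_leP _ iu).
Qed.

Lemma lsubmx_C1per (phi : 'rV[R]_n -> 'rV[R]_(n + 1)) : C1per phi ->
  C1per (fun x => lsubmx (phi x)).
Proof.
move=> cphi; apply: coord_C1per => j.
rewrite (_ : (fun _ => _) = fun x => phi x 0 (lshift 1 j)); first exact: C1per_coord.
by apply/funext => x; rewrite mxE.
Qed.

Lemma rsubmx_C1s (phi : 'rV[R]_n -> 'rV[R]_(n + 1)) : C1per phi ->
  C1s (fun x => rsubmx (phi x) 0 0).
Proof.
move=> cphi; rewrite (_ : (fun _ => _) = fun x => phi x 0 (rshift n 0)).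
  exact: C1per_coord.
by apply/funext => x; rewrite mxE.
Qed.

Lemma sqnorm_submx (v : 'rV[R]_(n + 1)) :
  sqnorm v = sqnorm (lsubmx v) + rsubmx v 0 0 ^+ 2.
Proof.
rewrite /sqnorm big_split_ord big_ord1 mxE; congr (_ + _).
by apply: eq_bigr => i _; rewrite mxE.
Qed.

Lemma pack_C1per (f : 'rV[R]_n -> 'rV[R]_n) (h : 'rV[R]_n -> R) : C1per f -> C1s h ->
  C1per (fun x => row_mx (f x) (const_mx (h x) : 'rV_1)).
Proof.
move=> cf ch; apply: coord_C1per => j; rewrite -[j]splitK.
case: (fintype.split j) => i /=.
  rewrite (_ : (fun _ => _) = fun x => f x 0 i); first exact: C1per_coord.
  by apply/funext => x; rewrite row_mxEl.
rewrite (_ : (fun _ => _) = h)//.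
by apply/funext => x; rewrite row_mxEr mxE.
Qed.

Lemma L1_mul_bdd u g M : continuous g -> (forall x, `|g x| <= M) -> L1 u ->
  L1 (fun x => u x * g x).
Proof. by move=> cg gM iu; exact: L1_mulr iu (continuous_measurable_rV cg) gM. Qed.

Section bounded_g.
Variables (g : 'rV[R]_n -> R) (M : R).
Hypotheses (cg : continuous g) (gM : forall x, `|g x| <= M).

(** Up to the factor c, a bound on F is a bound on the energy: a field with
    values in R^(n+1) is a pair of a field f and a function h. *)
Lemma F_leP c psi r : 0 < c -> L1 (expc c psi) ->
  (F g c psi <= r%:E)%E <->
  energy_le c (expc c psi) (intQ (fun x => expc c psi x * g x) + c * r).
Proof.
move=> c0 iu; set u := expc c psi in iu *.
have iug := L1_mul_bdd cg gM iu.
have Lt f h : C1per f -> C1s h -> L1 (fun x => u x * (div f x + c * h x)).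
  move=> cf ch.
  rewrite (_ : (fun _ => _) = fun x => u x * div f x + c * (u x * h x)).
    by apply: L1D; [exact: L1_mul_div|apply: L1Z; exact: L1_mul_C1s].
  by apply/funext => x; ring.
have E2 : (\int[leb n]_(x in Q) (u x / c * g x)%:E = (c^-1 * intQ (fun x => u x * g x))%:E)%E.
  rewrite -intQZ// -EFin_intQ; last exact: L1Z.
  by apply: eq_integral => x _; congr EFin; ring.
have E1 f h : C1per f -> C1s h ->
    (\int[leb n]_(x in Q) (u x * (div f x / c + h x))%:E =
      (c^-1 * intQ (fun x => u x * (div f x + c * h x)))%:E)%E.
  move=> cf ch; rewrite -intQZ; last exact: Lt.
  rewrite -EFin_intQ; last by apply: L1Z; exact: Lt.
  by apply: eq_integral => x _; congr EFin; field; exact: lt0r_neq0.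
rewrite /F -/u E2 leeBlDr// -EFinD; split => [H f h cf ch fh|J].
  suff : c^-1 * intQ (fun x => u x * (div f x + c * h x)) <= r + c^-1 * intQ (fun x => u x * g x).
    by rewrite ler_pdivrMl// mulrDr mulVKf ?lt0r_neq0// addrC.
  rewrite -lee_fin -E1//.
  apply: le_trans H; apply: ereal_sup_ubound.
  exists (fun x => row_mx (f x) (const_mx (h x) : 'rV_1)).
    split; first exact: pack_C1per.
    by move=> x; rewrite sqnorm_submx row_mxKl row_mxKr mxE.
  apply: eq_integral => x _; rewrite row_mxKr mxE.
  by under eq_fun do rewrite row_mxKl.
apply: ge_ereal_sup => _ [phi [cphi phi1] <-].
have cf := lsubmx_C1per cphi; have ch := rsubmx_C1s cphi.
rewrite (E1 _ _ cf ch) lee_fin ler_pdivrMl//.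
have -> : c * (r + c^-1 * intQ (fun x => u x * g x)) = intQ (fun x => u x * g x) + c * r.
  by field; exact: lt0r_neq0.
by apply: J => // x; rewrite -sqnorm_submx.
Qed.

End bounded_g.

Definition log_of c u (x : 'rV[R]_n) : \bar R :=
  if u x == 0 then -oo%E else (ln (u x) / c)%:E.

Lemma expc_log_of c u : 0 < c -> (forall x, 0 <= u x) -> expc c (log_of c u) = u.
Proof.
move=> c0 u0; apply/funext => x; rewrite /expc /log_of.
case: eqVneq => [->|ux].
  by rewrite mulr_infty gtr0_sg// mul1e.
by rewrite -EFinM mulrC divfK ?lt0r_neq0//= lnK// posrE lt_def ux u0.
Qed.

Lemma expc_ge0 c psi x : 0 <= expc c psi x.
Proof. by apply: fine_ge0; exact: expeR_ge0. Qed.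

Lemma expc_eq0 c psi x : 0 < c -> (psi x < +oo)%E -> expc c psi x = 0 -> psi x = -oo%E.
Proof.
move=> c0; rewrite /expc; case: (psi x) => [r _|//|//] /=.
by move=> /eqP; rewrite gt_eqF ?expR_gt0.
Qed.

Lemma expc_Ny c psi x : 0 < c -> psi x = -oo%E -> expc c psi x = 0.
Proof. by move=> c0 px; rewrite /expc px mulr_infty gtr0_sg// mul1e. Qed.

Lemma admissible_log_of c u T : 0 < c -> L1 u -> (forall x, 0 <= u x) -> TV_le u T ->
  admissible c (log_of c u).
Proof.
move=> c0 iu u0 TV; have /integrableP[/measurable_EFinP mu _] := iu; split.
- apply: measurable_fun_if => //; first exact: measurable_Q.
  + by apply: measurable_fun_eqr.
  + apply: (measurable_funS measurable_Q); first by move=> x [].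
    apply/measurable_EFinP; apply: measurable_funM => //.
    by apply: measurableT_comp mu; exact: measurable_ln.
- by move=> x _; rewrite /log_of; case: ifP => _; rewrite ?ltNyr ?ltry.
- by rewrite expc_log_of//; apply/BVperP; split => //; exists T.
Qed.

Lemma mass_eq0_ae u : L1 u -> (forall x, 0 <= u x) -> intQ u = 0 ->
  {ae leb n, forall x, Q x -> u x = 0}.
Proof.
move=> iu u0 I0.
have /integrableP[mu _] := iu.
have := (ae_eq_integral_abs (leb n) (@measurable_Q R n) mu).1.
rewrite (_ : (\int[_]_(x in _) _ = 0)%E).
  by move=> /(_ erefl); apply: filterS => x H Qx; case: (H Qx).
rewrite -[RHS](congr1 EFin I0) -EFin_intQ//.
by apply: eq_integral => x _; rewrite abse_EFin ger0_norm.
Qed.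

Lemma ae_eq0_mass u : L1 u -> {ae leb n, forall x, Q x -> u x = 0} -> intQ u = 0.
Proof.
move=> iu u0; have /integrableP[mu _] := iu.
rewrite /intQ /Rintegral (ae_eq_integral (cst 0%E))//; last first.
- by apply: filterS u0 => x H Qx /=; rewrite H.
- exact: measurable_Q.
by rewrite integral_cst ?mul0e//; exact: measurable_Q.
Qed.

(** For the densities exp (c psi), being nontrivial means having positive
    mass. *)
Lemma admissible_mass c psi : 0 < c -> admissible c psi ->
  ~ (psi = cst -oo%E %[ae leb n in Q]) <-> 0 < intQ (expc c psi).
Proof.
move=> c0 [mpsi psi_lt /BVperP[iu _]].
have I0 : 0 <= intQ (expc c psi) by apply: intQ_ge0 => x _; exact: expc_ge0.
split => [npsi|Ip].
  rewrite lt_def I0 andbT; apply/eqP => Iz; apply: npsi.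
  have := mass_eq0_ae iu (expc_ge0 c psi) Iz.
  apply: filterS => x H Qx; apply: (expc_eq0 c0); [exact: psi_lt|exact: H].
move=> psiN; have : intQ (expc c psi) = 0.
  apply: ae_eq0_mass => //; move: psiN; apply: filterS => x H Qx.
  by apply: expc_Ny => //; exact: H.
by move=> Iz; rewrite Iz ltxx in Ip.
Qed.

End functional.

(** * The threshold *)

Lemma lipschitz_continuous {R : realType} (V W : normedModType R) (f : V -> W) :
  lipschitz f -> continuous f.
Proof.
move=> /pinfty_ex_gt0[M M0 fM] x.
apply/cvgrPdist_lt => e e0; near=> y.
apply: (@le_lt_trans _ _ (M * `|x - y|)); first exact: (fM (x, y)).
rewrite mulrC -ltr_pdivlMr//; near: y.
by apply: cvgr_dist_lt => //; exact: divr_gt0.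
Unshelve. all: by end_near.
Qed.

Section threshold.
Context {R : realType} {n : nat} (hn : (0 < n)%N).
Variables (g : 'rV[R]_n -> R) (M : R).
Hypotheses (cg : continuous g) (gM : forall x, `|g x| <= M).
Implicit Types (u : 'rV[R]_n -> R) (c K : R).

(** In terms of densities u = exp (c psi): F takes a negative value at c. *)
Definition subcritical c := 0 < c /\ exists u K,
  [/\ L1 u, forall x, 0 <= u x, 0 < intQ u, energy_le c u K & K < intQ (fun x => u x * g x)].

Let L1g u : L1 u -> L1 (fun x => u x * g x).
Proof. exact: L1_mul_bdd cg gM. Qed.

Lemma subcritical_le c c' : 0 < c' <= c -> subcritical c -> subcritical c'.
Proof.
move=> /andP[c'0 c'c] [c0 [u [K [iu u0 m0 J KI]]]]; split => //.
exists u, K; split => //; apply: energy_le_mono J => //.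
by rewrite ltW.
Qed.

(** The energy is at least c times the mass. *)
Lemma subcritical_lt_sup c : subcritical c -> c < sup (g @` Q).
Proof.
move=> [c0 [u [K [iu u0 m0 J KI]]]].
have le_sup x : Q x -> g x <= sup (g @` Q).
  move=> Qx; apply: ub_le_sup; last by exists x.
  by exists M => _ [y _ <-]; exact: le_trans (ler_norm _) (gM y).
have : c * intQ u < sup (g @` Q) * intQ u.
  apply: le_lt_trans (energy_le_mass iu J) _; apply: lt_le_trans KI _.
  rewrite -intQZ//; apply: le_intQ; [exact: L1g|exact: L1Z|move=> x Qx].
  by rewrite mulrC ler_wpM2r// le_sup.
by rewrite ltr_pM2r.
Qed.

Lemma mean_subcritical c : 0 < c -> c < intQ g -> subcritical c.
Proof.
move=> c0 cg'; split => //; exists (fun=> 1), c; split => //.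
- exact: L1_cst.
- by rewrite intQ_cst.
- by apply: energy_le_cst1; exact: ltW.
- by rewrite (_ : intQ _ = intQ g)//; apply: eq_intQ => x _; rewrite mul1r.
Qed.

(** The energy of the indicator of A is at most Per A + c |A|, which is below
    the integral of g over A when c is small. *)
Lemma indicator_subcritical (A : set 'rV[R]_n) : measurable A -> A `<=` Q ->
  (Per A < +oo)%E -> (Per A < \int[leb n]_(x in A) (g x)%:E)%E ->
  exists c, subcritical c.
Proof.
move=> mA AQ PA_fin PA.
pose u : 'rV[R]_n -> R := \1_A.
have mu : measurable_fun setT u by exact: measurable_indic.
have u01 x : 0 <= u x <= 1 by rewrite /u indicE; case: (_ \in _); rewrite /= ?lexx ler01.
have u0 x : 0 <= u x by have /andP[] := u01 x.
have iu : L1 u.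
  by apply: (bounded_integrable_Q mu (M := 1)) => x; rewrite ger0_norm//; have /andP[] := u01 x.
have IA : (\int[leb n]_(x in A) (g x)%:E = (intQ (fun x => u x * g x))%:E)%E.
  rewrite -EFin_intQ; last exact: L1g.
  rewrite -{1}(setIidr AQ) integral_mkcondr; apply: eq_integral => x _.
  by rewrite patchE /u indicE; case: (_ \in _); rewrite ?mul1r ?mul0r.
pose P := fine (Per A).
have PE : Per A = P%:E by rewrite fineK// ge0_fin_numE// TVper_ge0.
have TV : TV_le u P by apply/(TVper_leP _ iu); rewrite -PE.
have P0 : 0 <= P by exact: TV_le_ge0 TV.
move: PA; rewrite IA PE lte_fin => PI.
have I1 : intQ u <= 1.
  by rewrite -(intQ_cst (n := n) 1); apply: le_intQ => //; [exact: L1_cst|move=> x _; have /andP[] := u01 x].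
have I0 : 0 < intQ u.
  have : 0 < M * intQ u.
    apply: (le_lt_trans P0); apply: lt_le_trans PI _; rewrite -intQZ//.
    apply: le_intQ; [exact: L1g|exact: L1Z|move=> x _].
    by rewrite mulrC ler_wpM2r// (le_trans (ler_norm _)).
  rewrite lt_def => MI; rewrite lt_def; apply/andP; split; last exact: intQ_ge0.
  by move: MI; rewrite mulf_eq0 negb_or => /andP[/andP[]].
pose c := (intQ (fun x => u x * g x) - P) / 2.
have c0 : 0 < c by rewrite divr_gt0// subr_gt0.
exists c; split => //; exists u, (P + c * intQ u); split => //.
  by apply: TV_le_energy_le => //; exact: ltW.
apply: (@le_lt_trans _ _ (P + c)); first by rewrite lerD2l ler_piMr// ltW.
rewrite /c; lra.
Qed.

(** The value is homogeneous in the density, so a density of negative value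
    gets below every r once multiplied by a large number. *)
Lemma F_scaled c r : subcritical c -> exists2 psi, admissible c psi & (F g c psi <= r%:E)%E.
Proof.
move=> [c0 [u [K [iu u0 m0 J KI]]]].
pose t := c * `|r| / (intQ (fun x => u x * g x) - K).
have d0 : 0 < intQ (fun x => u x * g x) - K by rewrite subr_gt0.
have t0 : 0 <= t by rewrite divr_ge0 ?mulr_ge0// ltW.
have Jt := energy_leZ iu t0 J.
have tu0 x : 0 <= t * u x by exact: mulr_ge0.
have itu := L1Z t iu.
exists (log_of c (fun x => t * u x)).
  by apply: admissible_log_of (energy_le_TV_le Jt).
have eu := expc_log_of c0 tu0.
apply/(F_leP cg gM _ c0); rewrite eu//.
suff -> : intQ (fun x => t * u x * g x) + c * r = t * K + (c * r + c * `|r|).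
  move=> f h cf ch fh; apply: le_trans (Jt f h cf ch fh) _.
  rewrite lerDl -mulrDr; apply: mulr_ge0; first exact: ltW.
  by have := ler_norm (- r); rewrite normrN; lra.
have -> : intQ (fun x => t * u x * g x) = t * intQ (fun x => u x * g x).
  by rewrite -intQZ; [apply: eq_intQ => x _; rewrite mulrA|exact: L1g].
have E : t * (intQ (fun x => u x * g x) - K) = c * `|r| by rewrite /t divfK ?gt_eqF.
by rewrite -E; ring.
Qed.

(** A density with a nonpositive value at c would have a negative one at c', by
    energy_le_strict. *)
Lemma F_pos c c' psi : 0 < c' < c -> ~ subcritical c' -> admissible c psi ->
  0 < intQ (expc c psi) -> (0 < F g c psi)%E.
Proof.
move=> /andP[c'0 c'c] nsub [_ _ /BVperP[iu _]] m0.
have c0 : 0 < c by exact: lt_trans c'c.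
rewrite ltNge; apply/negP => /(F_leP cg gM _ c0 iu); rewrite mulr0 addr0 => J.
have [|K J' KI] := @energy_le_strict _ _ c c' _ _ iu m0 _ J; first by rewrite c'0.
apply: nsub; split => //; exists (expc c psi), K; split => //.
exact: expc_ge0.
Qed.

Lemma F_ge0_mass0 c psi : 0 < c -> admissible c psi -> intQ (expc c psi) = 0 ->
  (0 <= F g c psi)%E.
Proof.
move=> c0 [_ _ /BVperP[iu _]] I0.
have ug0 : intQ (fun x => expc c psi x * g x) = 0.
  apply: ae_eq0_mass; first exact: L1g.
  by apply: filterS (mass_eq0_ae iu (expc_ge0 c psi) I0) => x H Qx; rewrite H// mul0r.
rewrite leNgt; apply/negP => F0.
have [r Fr r0] : exists2 r : R, (F g c psi <= r%:E)%E & r < 0.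
  case: (F g c psi) F0 => [s s0|//|_]; first by exists s => //; rewrite -lte_fin.
  by exists (-1); rewrite ?leNye// ltrN10.
have := (F_leP cg gM _ c0 iu).1 Fr; rewrite ug0 add0r => /energy_le_TV_le /TV_le_ge0.
by rewrite leNgt nmulr_llt0 ?c0 // pmulr_rlt0.
Qed.

Lemma F_Ny c : 0 < c -> admissible c (cst -oo%E : 'rV[R]_n -> \bar R) /\
  (F g c (cst -oo%E) <= 0)%E.
Proof.
move=> c0.
have e0 : expc c (cst -oo%E : 'rV[R]_n -> \bar R) = fun=> 0.
  by apply/funext => x; exact: expc_Ny.
have i0 := @L1_cst R n 0.
have z (h : 'rV[R]_n -> R) : intQ (fun x => 0 * h x) = 0.
  by rewrite -[RHS](intQ_cst (n := n)); apply: eq_intQ => x _; rewrite mul0r.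
split.
  split => //; rewrite e0; apply/BVperP; split => //.
  by exists 0 => f cf f1; rewrite z.
apply/(F_leP cg gM _ c0); rewrite e0// z mulr0 addr0 => f h cf ch fh.
by rewrite z.
Qed.

(** Take c_k increasing to c and densities u_k of mass 1 with negative values at
    c_k.  Their variation is at most the maximum of g, so they have a weak limit
    u.  It is the minimizer, because the energy is a supremum of weakly
    continuous functionals. *)
Lemma critical_minimizer c : 0 < c -> (forall c', 0 < c' < c -> subcritical c') ->
  exists u, [/\ L1 u, forall x, 0 <= u x, intQ u = 1 & energy_le c u (intQ (fun x => u x * g x))].
Proof.
move=> c0 sub.
pose c_ k : R := c * (1 - k.+2%:R^-1).
have cc k : 0 < c_ k < c.
  have k2 : 0 < (k.+2%:R : R)^-1 < 1 by rewrite invr_gt0 ltr0n invf_lt1// ltr1n.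
  move: k2 => /andP[k0 k1]; rewrite /c_ mulr_gt0 ?subr_gt0//=.
  by rewrite gtr_pMr// ltrBlDr ltrDl.
have c_c : c_ k @[k --> \oo] --> c.
  have H : (k.+2%:R : R)^-1 @[k --> \oo] --> (0 : R).
    by rewrite (cvg_shiftS (fun k => (k.+1%:R : R)^-1)); exact: cvg_harmonic.
  have : c_ k @[k --> \oo] --> c * (1 - 0).
    by apply: cvgM; [exact: cvg_cst|apply: cvgB; [exact: cvg_cst|exact: H]].
  by rewrite subr0 mulr1.
have /choice[uK uKP] : forall k, exists uK : ('rV[R]_n -> R) * R,
    [/\ L1 uK.1, forall x, 0 <= uK.1 x, intQ uK.1 = 1, energy_le (c_ k) uK.1 uK.2 &
      uK.2 < intQ (fun x => uK.1 x * g x)].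
  move=> k; have [ck0 [u [K [iu u0 m0 J KI]]]] := sub _ (cc k).
  have t0 : 0 <= (intQ u)^-1 by rewrite invr_ge0 ltW.
  exists (fun x => (intQ u)^-1 * u x, (intQ u)^-1 * K); split => /=.
  - exact: L1Z.
  - by move=> x; exact: mulr_ge0.
  - by rewrite intQZ// mulVf// gt_eqF.
  - exact: energy_leZ.
  - rewrite (_ : intQ (fun x => _ * _ * _) = (intQ u)^-1 * intQ (fun x => u x * g x)).
      by rewrite ltr_pM2l// invr_gt0.
    by rewrite -intQZ; [apply: eq_intQ => x _; rewrite mulrA|exact: L1g].
pose u_ k := (uK k).1.
have iu k : L1 (u_ k) by case: (uKP k).
have u0 k x : 0 <= u_ k x by have [_ H _ _ _] := uKP k; exact: H.
have u1 k : intQ (u_ k) = 1 by case: (uKP k).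
have Jk k : energy_le (c_ k) (u_ k) (intQ (fun x => u_ k x * g x)).
  move=> f h cf ch fh; case: (uKP k) => _ _ _ J /ltW; apply: le_trans.
  exact: J.
have gk k : intQ (fun x => u_ k x * g x) <= M.
  rewrite -[leRHS]mulr1 -(u1 k) -intQZ//; apply: le_intQ; [exact: L1g|exact: L1Z|move=> x _].
  by rewrite mulrC ler_wpM2r// (le_trans (ler_norm _)).
have TVk k : TV_le (u_ k) M.
  by move=> f cf f1; apply: le_trans (energy_le_TV_le (Jk k) cf f1) (gk k).
have [A [u [PA ooA Lu u_ge0 uW]]] := BV_compact hn iu (fun k x _ => u0 k x) u1 TVk.
exists u; split => //.
  have H : intQ (fun x => u_ k x * 1) @[k --> A] --> intQ (fun x => u x * 1).
    by apply: (uW (fun=> 1) 1) => x; [exact: cst_continuous|rewrite normr1].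
  have mul1 v : intQ (fun x : 'rV[R]_n => v x * 1) = intQ v by apply: eq_intQ => x _; rewrite mulr1.
  move: H; rewrite mul1; under eq_fun do rewrite mul1 u1.
  by move=> /(@cvg_unique _ (@norm_hausdorff _ _) _ _ _ _ (cvg_cst _)).
move=> f h cf ch fh.
have [D _ fD] := div_bounded cf.
have H1 := uW _ _ (continuous_div cf) fD.
have H2 := uW _ _ (C1s_continuous ch) (test_normr_le1 fh).
have H3 := uW _ _ cg gM.
have cA : c_ k @[k --> A] --> c by move=> X /c_c HX; exact: (ooA _ HX).
have H : intQ (fun x => u_ k x * (div f x + c_ k * h x)) @[k --> A] -->
    intQ (fun x => u x * (div f x + c * h x)).
  under eq_fun do rewrite (intQ_split _ (iu _) cf ch).
  rewrite (intQ_split _ Lu cf ch).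
  by apply: cvgD; [exact: H1|apply: cvgM; [exact: cA|exact: H2]].
apply: (ler_cvg_to H H3); apply: nearW => k; exact: (Jk k f h cf ch fh).
Qed.

(** A negative value at c would persist slightly above c. *)
Lemma F_critical c u : 0 < c -> (forall c', c < c' -> ~ subcritical c') ->
  L1 u -> (forall x, 0 <= u x) -> intQ u = 1 -> energy_le c u (intQ (fun x => u x * g x)) ->
  F g c (log_of c u) = 0%E.
Proof.
move=> c0 nsub iu u0 u1 J.
have eu := expc_log_of c0 u0.
have ieu : L1 (expc c (log_of c u)) by rewrite eu.
apply/eqP; rewrite eq_le; apply/andP; split.
  by apply/(F_leP cg gM _ c0 ieu); rewrite eu mulr0 addr0.
rewrite leNgt; apply/negP => F0.
have [r Fr r0] : exists2 r : R, (F g c (log_of c u) <= r%:E)%E & r < 0.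
  case: (F g c _) F0 => [s s0|//|_]; first by exists s => //; rewrite -lte_fin.
  by exists (-1); rewrite ?leNye// ltrN10.
have := (F_leP cg gM _ c0 ieu).1 Fr; rewrite eu => Jr.
pose d := - (c * r) / 2.
have cr0 : c * r < 0 by rewrite pmulr_rlt0.
have d0 : 0 < d by rewrite /d; lra.
apply: (nsub (c + d)); first by rewrite ltrDl.
split; first exact: addr_gt0.
exists u, (intQ (fun x => u x * g x) + c * r + `|c + d - c| * intQ u); split => //.
- by rewrite u1.
- exact: energy_le_shift.
- by rewrite u1 mulr1 [c + d]addrC addrK gtr0_norm// /d; lra.
Qed.

End threshold.

(** * Existence and uniqueness of the critical constant *)

Theorem corollary3p2 (R : realType) (n : nat) (hn : (1 <= n)%N)
  (g : 'rV[R]_n -> R) (g_lip : lipschitz g) (g_per : Zperiodic g)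
  (hA : exists A : set 'rV[R]_n,
    [/\ measurable A, A `<=` Q, (Per A < +oo)%E
      & (Per A < \int[leb n]_(x in A) (g x)%:E)%E]) :
  exists! cbar : R,
    [/\ 0 < cbar,
        (\int[leb n]_(x in Q) (g x)%:E <= cbar%:E)%E /\ cbar <= sup (g @` Q),
        forall c : R, 0 < c < cbar ->
          ereal_inf [set F g c psi | psi in admissible c] = -oo%E,
        forall c : R, cbar < c ->
          ereal_inf [set F g c psi | psi in admissible c] = 0%E /\
          forall psi : 'rV[R]_n -> \bar R, admissible c psi ->
            ~ (psi = cst -oo%E %[ae leb n in Q]) -> (0 < F g c psi)%E
      & exists psi : 'rV[R]_n -> \bar R,
          [/\ admissible cbar psi, ~ (psi = cst -oo%E %[ae leb n in Q])
            & F g cbar psi = 0%E]].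
Proof.
have cg : continuous g := lipschitz_continuous g_lip.
have [M _ gM] := Zperiodic_bounded cg g_per.
have [A [mA AQ PA_fin PA]] := hA.
have [c0 sub0] := indicator_subcritical cg gM mA AQ PA_fin PA.
pose S : set R := [set c | subcritical g c].
have S_ub : ubound S (sup (g @` Q)).
  by move=> c /(subcritical_lt_sup cg gM) /ltW.
have S_sup : has_sup S by split; [exists c0|exists (sup (g @` Q))].
set cbar := sup S.
have le_cbar c : subcritical g c -> c <= cbar.
  by move=> Sc; apply: sup_upper_bound.
have cbar0 : 0 < cbar by apply: lt_le_trans (le_cbar _ sub0); case: sub0.
have below c : 0 < c < cbar -> subcritical g c.
  move=> /andP[c_gt0 cc].
  have [c1 Sc1 c1c] := sup_gt S_sup.1 cc.
  by apply: subcritical_le Sc1; rewrite c_gt0 ltW.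
have above c : cbar < c -> ~ subcritical g c.
  by move=> cc /le_cbar; rewrite leNgt cc.
have Lg : L1 g by exact: bounded_integrable_Q (continuous_measurable_rV cg) gM.
have lo0 c : 0 < c < cbar -> ereal_inf [set F g c psi | psi in admissible c] = -oo%E.
  move=> cc; apply: eq_ninfty => r.
  have [psi Apsi Fr] := F_scaled cg gM r (below c cc).
  by apply: le_trans Fr; apply: ereal_inf_lbound; exists psi.
have hi1 c psi : cbar < c -> admissible c psi -> 0 < intQ (expc c psi) -> (0 < F g c psi)%E.
  move=> cc; have [mid1 mid2] := midf_lt cc.
  apply: (F_pos cg gM _ (above _ mid1)).
  by rewrite mid2 (lt_trans cbar0 mid1).
have hi0 c : cbar < c -> ereal_inf [set F g c psi | psi in admissible c] = 0%E.
  move=> cc; have c_gt0 : 0 < c by exact: lt_trans cc.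
  apply/eqP; rewrite eq_le; apply/andP; split.
    have [AN FN] := F_Ny cg gM c_gt0.
    by apply: le_trans FN; apply: ereal_inf_lbound; exists (cst -oo%E).
  apply: le_ereal_inf_tmp => _ [psi Apsi <-].
  have [I0|I0] := eqVneq (intQ (expc c psi)) 0.
    exact: (F_ge0_mass0 cg gM).
  apply/ltW/hi1 => //; rewrite lt_def I0/=.
  by apply: intQ_ge0 => x _; exact: expc_ge0.
exists cbar; split.
  split => //.
  - split; last exact: ge_sup S_sup.1 S_ub.
    rewrite EFin_intQ// lee_fin leNgt; apply/negP => lt_cg.
    have [mid1 mid2] := midf_lt lt_cg.
    apply: (above _ mid1); apply: mean_subcritical mid2.
    exact: lt_trans mid1.
  - move=> c cc; split; first exact: hi0.
    move=> psi Apsi npsi; apply: hi1 => //.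
    by apply/(admissible_mass _ Apsi); first exact: lt_trans cc.
  - have [u [iu u0 u1 J]] := critical_minimizer hn cg gM cbar0 below.
    have Apsi := admissible_log_of cbar0 iu u0 (energy_le_TV_le J).
    exists (log_of cbar u); split => //.
      by apply/(admissible_mass cbar0 Apsi); rewrite expc_log_of// u1.
    exact: (F_critical cg gM).
move=> c' [c'0 _ lo hi _].
have no c : ereal_inf [set F g c psi | psi in admissible c] = -oo%E ->
    ereal_inf [set F g c psi | psi in admissible c] = 0%E -> False.
  by move=> ->.
have [lt|gt|//] := ltgtP cbar c'.
- have [mid1 mid2] := midf_lt lt.
  by exfalso; apply: (no _ (lo _ _) (hi0 _ mid1)); rewrite mid2 (lt_trans cbar0).
- have [mid1 mid2] := midf_lt gt.
  by exfalso; apply: (no _ (lo0 _ _) (hi _ mid1).1); rewrite mid2 (lt_trans c'0).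
Qed.
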